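(* Let $g:\mathbb{S}^{N-1}\times\mathbb{S}^{N-1}\times(0,\infty)\to[0,\infty)$ have the separated variables expression $g(\sigma^-,\sigma^+,r)=g_1(\sigma^-,\sigma^+)\,\xi(r)$, where $g_1:\mathbb{S}^{N-1}\times\mathbb{S}^{N-1}\to[0,\infty)$ and $\xi:(0,\infty)\to[0,\infty)$ are of class $C^1$ and $$\int_0^\infty\xi(r)(1+r)(e^r\sinh r)^{N-1}\,dr<\infty.$$ Then the function $\widetilde G:T\mathbb{H}^N\to[0,\infty)$ given by $\widetilde G(x,V)=g(\sigma^-(x,V),\sigma^+(x,V),|V|)$ for $V\ne0$ in $T_x\mathbb{H}^N$ (with arbitrary non-negative values on the zero section) satisfies Hypotheses (A), (B) and (C) stated in the context.
   Context: $\mathbb{H}^N$ is the $N$-dimensional hyperbolic space in the Poincaré ball model: the open unit ball $B^N\subset\mathbb{R}^N$ with metric $\lambda^2(x)\delta_{ij}$, $\lambda(x)=\frac{2}{1-|x|_e^2}$ ($|\cdot|_e$ Euclidean norm). $|\cdot|$ is the hyperbolic norm on tangent vectors, and $d\mu(W)$ on $T_x\mathbb{H}^N$ is the Lebesgue measure induced by the inner product. The boundary at infinity is identified with the unit sphere $\mathbb{S}^{N-1}$. For $(x,V)\in T\mathbb{H}^N$, $\gamma_{x,V}$ is the geodesic with $\gamma_{x,V}(0)=x$, $\gamma'_{x,V}(0)=V$; for $V\neq0$, $\sigma^-(x,V)=\lim_{t\to-\infty}\gamma_{x,V}(t)$ and $\sigma^+(x,V)=\lim_{t\to+\infty}\gamma_{x,V}(t)$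 in $\mathbb{S}^{N-1}$ are its initial and final points at infinity. The geodesic flow is $\Phi_t(x,V)=(\gamma_{x,V}(t),\gamma_{x,V}'(t))$, and $\widetilde G$ is invariant under it if $\widetilde G(\Phi_t(x,V))=\widetilde G(x,V)$ for all $t\in\mathbb{R}$, $(x,V)\in T\mathbb{H}^N$. Hypothesis (A): $\widetilde G:T\mathbb{H}^N\to[0,\infty)$ is of class $C^1$ outside the zero section and invariant under the geodesic flow (the associated kernel being $G(x,y):=\widetilde G(x,V_{x,y})$ for distinct $x,y$, where $\exp_x(V_{x,y})=y$). Hypothesis (B): with $k_{\widetilde G}(r):=\sup_{x\in\mathbb{H}^N,\,|W|=r}\widetilde G(x,W)$, $$\operatorname{Vol}(\mathbb{S}^{N-1})\int_0^\infty k_{\widetilde G}(r)(1+r)(e^r\sinh r)^{N-1}\,dr<\infty.$$ Hypothesis (C): the vector field $X_G(x):=-\int_{T_x\mathbb{H}^N}\widetilde G(x,W)\,W\,d\mu(W)$ is of class $C^1$ on $\mathbb{H}^N$. *)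

(* Defs.v *)
From HB Require Import structures.
From mathcomp Require Import all_boot all_order all_algebra.
From mathcomp Require Import all_classical all_reals all_analysis.
From mathcomp Require Import interval_inference.

Set Implicit Arguments.
Unset Strict Implicit.
Unset Printing Implicit Defensive.
Import Order.TTheory GRing.Theory Num.Theory.
Import numFieldNormedType.Exports.

Local Open Scope classical_set_scope.
Local Open Scope ring_scope.

(* R^N carries the product sigma-algebra of its coordinates, which is its Borel
   sigma-algebra. *)
Section measurable_rV.
Context {R : realType}.
Variable n : nat.

Let coords : 'I_n -> 'rV[R]_n -> R := fun i v => v ord0 i.

Let rV_set0 : g_sigma_preimage coords set0.
Proof. exact: sigma_algebra0. Qed.

Let rV_setC A : g_sigma_preimage coords A -> g_sigma_preimage coords (~` A).
Proof. exact: sigma_algebraC. Qed.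

Let rV_bigcup (F : _^nat) : (forall i, g_sigma_preimage coords (F i)) ->
  g_sigma_preimage coords (\bigcup_i (F i)).
Proof. exact: sigma_algebra_bigcup. Qed.

HB.instance Definition _ := @isMeasurable.Build default_measure_display
  'rV[R]_n (g_sigma_preimage coords) rV_set0 rV_setC rV_bigcup.

End measurable_rV.

Lemma measurable_rV_coord (R : realType) n (i : 'I_n) :
  measurable_fun [set: 'rV[R]_n] (fun v => v ord0 i).
Proof.
move=> _ Y mY; rewrite setTI; apply: sub_sigma_algebra => /=.
rewrite -bigcup_seq/=; exists i => /=; first by rewrite mem_index_enum.
by exists Y => //; rewrite setTI.
Qed.

Lemma measurable_fun_rVP (R : realType) d (T : measurableType d) n
    (f : T -> 'rV[R]_n) :
  measurable_fun setT f <-> forall i, measurable_fun setT (fun x => f x ord0 i).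
Proof.
split=> [mf i|mf]; first exact: measurableT_comp (measurable_rV_coord i) mf.
apply: (@measurability _ _ _ _ _ _
  (\big[setU/set0]_(i < n) preimage_set_system setT
     (fun v : 'rV[R]_n => v ord0 i) measurable)) => //.
move=> _ [B + <-]; rewrite -bigcup_seq => -[i _ [C mC <-]].
by rewrite !setTI -comp_preimage -[X in measurable X]setTI; exact: mf.
Qed.

Section lebesgue_rV.
Context {R : realType}.

Definition consv n (p : measurableTypeR R * 'rV[R]_n) : 'rV[R]_n.+1 :=
  row_mx (p.1%:M : 'M[R]_1) p.2.

Lemma consvE n (p : R * 'rV[R]_n) (i : 'I_n.+1) :
  consv p ord0 i = if unlift ord0 i is Some j then p.2 ord0 j else p.1.
Proof.
rewrite /consv mxE; case: (unliftP ord0 i) => [j ->|->].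
  case: splitP => [k|k /= jk]; first by rewrite ord1.
  by congr (p.2 _ _); apply/val_inj; move: jk => /=; rewrite /bump/= add1n => -[].
by case: splitP => [k _|//]; rewrite !ord1 mxE.
Qed.

Lemma measurable_consv n : measurable_fun setT (@consv n).
Proof.
apply: (measurable_fun_rVP _).2 => i; case: (unliftP ord0 i) => [j ->|->].
  rewrite (_ : (fun _ => _) = (fun v : 'rV[R]_n => v ord0 j) \o snd).
    by apply: measurableT_comp => //; exact: measurable_rV_coord.
  by apply/funext => p /=; rewrite consvE liftK.
rewrite (_ : (fun _ => _) = fst)//.
by apply/funext => p /=; rewrite consvE unlift_none.
Qed.

Definition unconsv n (v : 'rV[R]_n.+1) : measurableTypeR R * 'rV[R]_n :=
  (v ord0 ord0, \row_j v ord0 (lift ord0 j)).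

Lemma consvK n : cancel (@consv n) (@unconsv n).
Proof.
move=> [x v]; rewrite /unconsv consvE unlift_none /=; congr pair.
by apply/rowP => j; rewrite mxE consvE liftK.
Qed.

Lemma unconsvK n : cancel (@unconsv n) (@consv n).
Proof.
move=> v; apply/rowP => i; rewrite consvE.
by case: (unliftP ord0 i) => [j ->|->] //=; rewrite mxE.
Qed.

Lemma measurable_unconsv n : measurable_fun setT (@unconsv n).
Proof.
apply: measurable_fun_pair; first exact: measurable_rV_coord.
apply: (measurable_fun_rVP _).2 => i.
rewrite (_ : (fun _ => _) = (fun v : 'rV[R]_n.+1 => v ord0 (lift ord0 i))).
  exact: measurable_rV_coord.
by apply/funext => v /=; rewrite mxE.
Qed.

Section step.
Variables (n : nat) (mu : {sigma_finite_measure set 'rV[R]_n -> \bar R}).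

Definition lebesgue_step : set 'rV[R]_n.+1 -> \bar R :=
  pushforward (lebesgue_measure \x mu)%E (@consv n).

Let step0 : lebesgue_step set0 = 0%E.
Proof. by rewrite /lebesgue_step /pushforward preimage_set0 measure0. Qed.

Let step_ge0 A : (0 <= lebesgue_step A)%E.
Proof. by apply: integral_ge0 => x _; exact: measure_ge0. Qed.

Let step_sigma_additive : semi_sigma_additive lebesgue_step.
Proof.
move=> F mF tF mUF; rewrite /lebesgue_step /pushforward preimage_bigcup.
have mc A : measurable A -> measurable (@consv n @^-1` A).
  by move=> mA; rewrite -[X in measurable X]setTI; exact: measurable_consv.
apply: measure_semi_sigma_additive.
- by move=> k; exact: mc.
- apply/trivIsetP => /= i j _ _ ij; rewrite -preimage_setI.
  by move/trivIsetP : tF => /(_ _ _ _ _ ij) ->//; rewrite preimage_set0.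
- by rewrite -preimage_bigcup; exact: mc.
Qed.

HB.instance Definition _ := isMeasure.Build _ _ _ lebesgue_step
  step0 step_ge0 step_sigma_additive.

Let step_sigma_finite : sigma_finite setT lebesgue_step.
Proof.
have /sigma_finiteP[F [TF ndF Foo]] := sigma_finiteT (@lebesgue_measure R).
have /sigma_finiteP[G [TG ndG Goo]] := sigma_finiteT mu.
exists (fun k => @unconsv n @^-1` (F k `*` G k)).
  rewrite -preimage_bigcup (_ : \bigcup_i _ = setT) ?preimage_setT//.
  rewrite -subTset => -[x y] _.
  have [i _ Fx] : (\bigcup_i F i) x by rewrite -TF.
  have [j _ Gy] : (\bigcup_i G i) y by rewrite -TG.
  exists (maxn i j) => //; split => /=.
    by move: x Fx; exact/subsetPset/ndF/leq_maxl.
  by move: y Gy; exact/subsetPset/ndG/leq_maxr.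
move=> k; have [mF Fk] := Foo k; have [mG Gk] := Goo k; split.
  rewrite -[X in measurable X]setTI; apply: measurable_unconsv => //.
  exact: measurableX.
rewrite /lebesgue_step /pushforward -comp_preimage.
rewrite (_ : _ \o _ = id); last by rewrite funeqE => p /=; rewrite consvK.
by rewrite preimage_id product_measure1E// lte_mul_pinfty// ge0_fin_numE.
Qed.

HB.instance Definition _ := Measure_isSigmaFinite.Build _ _ _ lebesgue_step
  step_sigma_finite.

End step.

Fixpoint lebesgue_rV n : {sigma_finite_measure set 'rV[R]_n -> \bar R} :=
  match n with
  | 0 => \d_(0 : 'rV[R]_0)
  | n'.+1 => lebesgue_step (lebesgue_rV n')
  end.

End lebesgue_rV.

(* The Borel sigma-algebra and volumes of boxes determine this measure. *)
Lemma lebesgue_rV_box (R : realType) n (A : 'I_n -> set R) :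
  (forall i, measurable (A i)) ->
  lebesgue_rV n [set v | forall i, A i (v ord0 i)] =
  (\prod_(i < n) lebesgue_measure (A i))%E.
Proof.
elim: n A => [|n IHn] A mA.
  rewrite big_ord0 /= diracE mem_set//= => -[]//.
rewrite big_ord_recl /= /lebesgue_step /pushforward.
rewrite (_ : _ @^-1` _ = A ord0 `*`
    [set v : 'rV[R]_n | forall i, A (lift ord0 i) (v ord0 i)]); last first.
  apply/seteqP; split => -[x v] /=.
    move=> Av; split; first by have := Av ord0; rewrite consvE unlift_none.
    by move=> i; have := Av (lift ord0 i); rewrite consvE liftK.
  move=> [Ax Av] i; rewrite consvE.
  by case: (unliftP ord0 i) => [j ->|->].
rewrite product_measure1E; first by congr (_ * _)%E; apply: IHn => i; exact: mA.
  exact: mA.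
rewrite (_ : [set v | _] = \bigcap_(i in [set: 'I_n])
    ((fun v : 'rV[R]_n => v ord0 i) @^-1` A (lift ord0 i))); last first.
  by apply/seteqP; split => v /= Av i; [move=> _|]; exact: Av.
apply: fin_bigcap_measurable; first exact: finite_finset.
move=> i _; rewrite -[X in measurable X]setTI.
exact: measurable_rV_coord.
Qed.

Section calculus.
Context {R : realType}.

(* Class C^1 on an open set U; pointwise continuity of the differential is
   continuity in operator norm as all spaces below are finite-dimensional. *)
Definition C1_on (V W : normedModType R) (U : set V) (f : V -> W) : Prop :=
  forall x, U x ->
    differentiable f x /\ forall v, {for x, continuous (fun y => 'd f y v)}.

(* Class C^1 on an embedded submanifold E: local C^1 extensions exist. *)
Definition C1_on_submanifold (V W : normedModType R) (E : set V) (f : V -> W) :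
    Prop :=
  forall x, E x -> exists (U : set V) (h : V -> W),
    [/\ open U, U x, C1_on U h & forall y, (U `&` E) y -> h y = f y].

Definition sinh (r : R) : R := (expR r - expR (- r)) / 2.

Definition radial_weight (n : nat) (r : R) : R :=
  (1 + r) * (expR r * sinh r) ^+ n.-1.

Definition enorm n (x : 'rV[R]_n) : R := Num.sqrt (\sum_i x ord0 i ^+ 2).

Definition esphere n : set 'rV[R]_n := [set x | enorm x = 1].

Definition cone n (A : set 'rV[R]_n) : set 'rV[R]_n :=
  [set v | exists (t : R) (s : 'rV[R]_n), [/\ 0 < t <= 1, A s & v = t *: s]].

(* Surface measure on the unit sphere, defined through polar coordinates. *)
Definition sphere_measure n (A : set 'rV[R]_n) : \bar R :=
  (n%:R%:E * lebesgue_rV n (cone A))%E.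

End calculus.
Arguments esphere : clear implicits.

Section hyperbolic_space.
Context {R : realType} {N : nat}.
Implicit Types (x V W : 'rV[R]_N) (gam : R -> 'rV[R]_N).
Implicit Type G : 'rV[R]_N -> 'rV[R]_N -> R.

Definition hball : set 'rV[R]_N := [set x | enorm x < 1].

Definition conformal_factor x : R := 2 / (1 - enorm x ^+ 2).

Definition hmetric x : 'M[R]_N := (conformal_factor x ^+ 2)%:M.

Definition hnorm x V : R := Num.sqrt ((V *m hmetric x *m V^T) ord0 ord0).

Definition partial (i : 'I_N) (f : 'rV[R]_N -> R) x : R :=
  'D_(delta_mx ord0 i) f x.

Definition christoffel (k i j : 'I_N) x : R :=
  2^-1 * \sum_l invmx (hmetric x) k l *
    (partial i (fun y => hmetric y j l) x
     + partial j (fun y => hmetric y i l) x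
     - partial l (fun y => hmetric y i j) x).

Definition is_geodesic gam : Prop :=
  forall t, [/\ hball (gam t), derivable gam t 1, derivable (derive1 gam) t 1 &
    forall k, derive1n 2 gam t ord0 k + \sum_i \sum_j
      christoffel k i j (gam t) * derive1 gam t ord0 i * derive1 gam t ord0 j = 0].

(* The geodesic exists and is unique when hball x holds. *)
Definition geodesic x V : R -> 'rV[R]_N :=
  get [set gam | [/\ is_geodesic gam, gam 0 = x & derive1 gam 0 = V]].

Definition geodesic_flow (t : R) (p : 'rV[R]_N * 'rV[R]_N) :
    'rV[R]_N * 'rV[R]_N :=
  (geodesic p.1 p.2 t, derive1 (geodesic p.1 p.2) t).

Definition sigma_minus x V : 'rV[R]_N := lim (geodesic x V t @[t --> -oo]).
Definition sigma_plus x V : 'rV[R]_N := lim (geodesic x V t @[t --> +oo]).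

Definition tangent_volume x : set 'rV[R]_N -> \bar R :=
  mscale (NngNum (sqrtr_ge0 (\det (hmetric x)))) (lebesgue_rV N).

HB.instance Definition _ x := Measure.on (tangent_volume x).

Definition hypothesisA G : Prop :=
  [/\ forall x V, hball x -> 0 <= G x V,
      C1_on [set p : 'rV[R]_N * 'rV[R]_N | hball p.1 /\ p.2 != 0]
        (fun p => G p.1 p.2) &
      forall t p, hball p.1 ->
        G (geodesic_flow t p).1 (geodesic_flow t p).2 = G p.1 p.2].

Definition sup_kernel G (r : R) : \bar R :=
  ereal_sup [set (G p.1 p.2)%:E |
    p in [set p : 'rV[R]_N * 'rV[R]_N | hball p.1 /\ hnorm p.1 p.2 = r]].

Definition hypothesisB G : Prop :=
  (sphere_measure (esphere R N) *
   \int[lebesgue_measure]_(r in `]0%R, +oo[)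
     (sup_kernel G r * (radial_weight N r)%:E) < +oo)%E.

Definition mean_field G x : 'rV[R]_N :=
  - \row_i \int[tangent_volume x]_W (G x W * W ord0 i).

(* The first conjunct says that the integral defining the field converges, as
   Rintegral is total. *)
Definition hypothesisC G : Prop :=
  (forall x i, hball x -> (tangent_volume x).-integrable setT
     (fun W => (G x W * W ord0 i)%:E)) /\
  C1_on hball (mean_field G).

End hyperbolic_space.

(* Main.v *)
(* Lifting the ball to the hyperboloid turns the geodesic equation into the
   linear equation X'' = c^2 X, where c is the constant speed. This gives
   uniqueness of geodesics and the endpoints at infinity
     sigma^{+-}(x, V) = S(x, +-V/|V|_e),
     S(x, u) = (lambda (1 + <x, u>) x + u) / (lambda (1 + <x, u>) - 1),
   lambda being the conformal factor at x. Hence G(x, V) is the product of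
   K(x, V) = g_1(S(x, -V/|V|_e), S(x, V/|V|_e)), of class C^1 for V <> 0, and
   xi(lambda |V|_e); this is (A), and (B) follows since g_1 is bounded on the
   compact product of spheres. As K is homogeneous of degree 0 in V, the
   substitution Z = lambda W gives
     X_G(x) = - lambda^-1 \int K(x, Z) xi(|Z|_e) Z dZ,
   in which x no longer enters xi: no bound on xi' is needed, and
   differentiation under the integral only uses that K(x, u) is differentiable
   in x uniformly in u on the compact unit sphere, together with the convergence
   of \int xi(|Z|_e) |Z|_e dZ, which is checked in polar coordinates. *)

Require Import Defs.
From HB Require Import structures.
From mathcomp Require Import all_boot all_order all_algebra.
From mathcomp Require Import all_classical all_reals all_analysis.
From mathcomp Require Import measurable_realfun ring lra.
Set Implicit Arguments.
Unset Strict Implicit.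
Unset Printing Implicit Defensive.
Import Order.TTheory GRing.Theory Num.Theory.
Import numFieldNormedType.Exports.
Local Open Scope classical_set_scope.
Local Open Scope ring_scope.

(** * Euclidean algebra and the Christoffel symbols of the ball *)

(** Uniqueness of geodesics reduces to scalar equations z'' = c^2 z with zero initial data. In the
    null directions of the hyperboloid the solutions are e^{ct} (p, P) + e^{-ct} (r, Q). A
    translation of time only rescales the two terms, so the endpoints P/p and Q/r are visibly
    constant along the geodesic flow. The obstacle in (C) is that [C1_on] gives continuity of the
    differential one vector at a time, whereas differentiation under the integral requires a
    remainder of at most e |h| for all directions u at once. Finite dimension upgrades continuity to
    the operator norm, the mean value theorem then gives strict differentiability, and compactness
    of the sphere makes it uniform. The integrated remainder is at most e |h| times the integral of
    |xi(|Z|) Z_i|. That integral is finite because e^r sinh r = (e^{2r} - 1) / 2 >= r, so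
    [radial_weight] dominates the factor r^N produced by polar coordinates. *)

Section euclidean.
Context {R : realType} {n : nat}.
Implicit Types x y z : 'rV[R]_n.

Definition edot x y : R := \sum_i x ord0 i * y ord0 i.

Lemma edotC x y : edot x y = edot y x.
Proof. by apply: eq_bigr => i _; rewrite mulrC. Qed.

Lemma edotDl x y z : edot (x + y) z = edot x z + edot y z.
Proof. by rewrite -big_split; apply: eq_bigr => i _; rewrite mxE mulrDl. Qed.

Lemma edotZl a x y : edot (a *: x) y = a * edot x y.
Proof. by rewrite big_distrr; apply: eq_bigr => i _; rewrite mxE/= mulrA. Qed.

Lemma edotDr x y z : edot x (y + z) = edot x y + edot x z.
Proof. by rewrite edotC edotDl !(edotC x). Qed.

Lemma edotZr a x y : edot x (a *: y) = a * edot x y.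
Proof. by rewrite edotC edotZl edotC. Qed.

Lemma edotNl x y : edot (- x) y = - edot x y.
Proof. by rewrite -scaleN1r edotZl mulN1r. Qed.

Lemma edotNr x y : edot x (- y) = - edot x y.
Proof. by rewrite edotC edotNl edotC. Qed.

Definition edotE := (edotDl, edotDr, edotZl, edotZr, edotNl, edotNr).

Lemma edot_ge0 x : 0 <= edot x x.
Proof. by apply: sumr_ge0 => i _; rewrite -expr2 sqr_ge0. Qed.

Lemma edot_eq0 x : (edot x x == 0) = (x == 0).
Proof.
apply/idP/eqP => [|->]; last by rewrite /edot big1// => i _; rewrite mxE mul0r.
rewrite psumr_eq0; last by move=> i _; rewrite -expr2 sqr_ge0.
move=> /allP h; apply/rowP => i; rewrite mxE; apply/eqP.
by have /= := h i (mem_index_enum _); rewrite mulf_eq0 orbb.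
Qed.

Lemma enormE x : enorm x = Num.sqrt (edot x x).
Proof. by congr Num.sqrt; apply: eq_bigr => i _; rewrite expr2. Qed.

Lemma sqr_enorm x : enorm x ^+ 2 = edot x x.
Proof. by rewrite enormE sqr_sqrtr// edot_ge0. Qed.

Lemma enorm_ge0 x : 0 <= enorm x.
Proof. by rewrite enormE sqrtr_ge0. Qed.

Lemma enorm_eq0 x : (enorm x == 0) = (x == 0).
Proof. by rewrite -edot_eq0 -sqr_enorm sqrf_eq0. Qed.

Lemma enorm_gt0 x : (0 < enorm x) = (x != 0).
Proof. by rewrite lt0r enorm_ge0 andbT enorm_eq0. Qed.

Lemma enormZ a x : enorm (a *: x) = `|a| * enorm x.
Proof.
by rewrite !enormE !edotE mulrA -expr2 sqrtrM ?sqr_ge0// sqrtr_sqr.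
Qed.

Lemma hball_edot x : hball x <-> edot x x < 1.
Proof.
rewrite /hball/= -sqr_enorm; split => [x1|].
  by rewrite expr_lt1// enorm_ge0.
by rewrite expr_lt1// enorm_ge0.
Qed.

Lemma esphere_edot x : esphere R n x <-> edot x x = 1.
Proof.
rewrite /esphere/= -sqr_enorm; split => [->|]; first by rewrite expr1n.
by move/eqP; rewrite sqrp_eq1 ?enorm_ge0// => /eqP.
Qed.

Lemma conformal_factorE x : conformal_factor x = 2 / (1 - edot x x).
Proof. by rewrite /conformal_factor sqr_enorm. Qed.

Lemma conformal_factor_gt0 x : hball x -> 0 < conformal_factor x.
Proof.
by move/hball_edot => x1; rewrite conformal_factorE divr_gt0// subr_gt0.
Qed.

Lemma hnormE x (v : 'rV[R]_n) : hball x -> hnorm x v =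
  conformal_factor x * enorm v.
Proof.
move=> xb; rewrite /hnorm /hmetric mul_mx_scalar -scalemxAl mxE mxE.
rewrite (_ : \sum_j _ = edot v v); last by apply: eq_bigr => i _; rewrite mxE.
by rewrite sqrtrM ?sqr_ge0// sqrtr_sqr gtr0_norm ?conformal_factor_gt0// enormE.
Qed.

End euclidean.

Section derive_rules.
Context {R : realType} {V : normedModType R}.
Implicit Types (f g : V -> R) (x v : V).

Lemma is_derive_addf f g x v df dg : is_derive x v f df -> is_derive x v g dg ->
  is_derive x v (fun y => f y + g y) (df + dg).
Proof. exact: is_deriveD. Qed.

Lemma is_derive_subf f g x v df dg : is_derive x v f df -> is_derive x v g dg ->
  is_derive x v (fun y => f y - g y) (df - dg).
Proof. exact: is_deriveB. Qed.

Lemma is_derive_mulf f g x v df dg : is_derive x v f df -> is_derive x v g dg ->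
  is_derive x v (fun y => f y * g y) (df * g x + f x * dg).
Proof.
by move=> hf hg; apply: is_derive_eq;
  rewrite /GRing.scale/= addrC (mulrC (g x)).
Qed.

Lemma is_derive_sqrf f x v df : is_derive x v f df ->
  is_derive x v (fun y => f y ^+ 2) (2 * f x * df).
Proof.
move=> hf; rewrite (_ : (fun _ => _) = fun y => f y * f y).
  by apply: (is_derive_eq (is_derive_mulf hf hf)); ring.
by apply/funext => y; rewrite expr2.
Qed.

Lemma is_derive_mulc (k : R) f x v df : is_derive x v f df ->
  is_derive x v (fun y => k * f y) (k * df).
Proof. exact: is_deriveZ. Qed.

Lemma is_derive_invf f x v df : f x != 0 -> is_derive x v f df ->
  is_derive x v (fun y => (f y)^-1) (- df / f x ^+ 2).
Proof.
move=> fx0 [hf <-]; apply: DeriveDef; first exact: derivableV.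
by rewrite deriveV// /GRing.scale/= mulNr mulrC mulNr.
Qed.

Lemma is_derive_sumf n (h : 'I_n -> V -> R) x v (dh : 'I_n -> R) :
  (forall i, is_derive x v (h i) (dh i)) ->
  is_derive x v (fun y => \sum_(i < n) h i y) (\sum_(i < n) dh i).
Proof.
move=> hd; rewrite (_ : (fun _ => _) = \sum_(i < n) h i).
  exact: is_derive_sum.
by apply/funext => y; rewrite fct_sumE.
Qed.

End derive_rules.

Section christoffel.
Context {R : realType} {n : nat}.
Implicit Types x v : 'rV[R]_n.

Lemma is_derive_coord x v j : is_derive x v (fun y : 'rV[R]_n => y ord0 j)
  (v ord0 j).
Proof.
apply: DeriveDef.
  by apply: diff_derivable; exact: differentiable_coord.
apply: cvg_lim => //; apply: cvg_near_cst; near=> h.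
rewrite /= !mxE addrK /GRing.scale/= mulKf//.
by near: h; exact: nbhs_dnbhs_neq.
Unshelve. all: by end_near. Qed.

Lemma is_derive_edot_diag x v :
  is_derive x v (fun y : 'rV[R]_n => edot y y) (2 * edot x v).
Proof.
rewrite (_ : 2 * _ = \sum_i (v ord0 i * x ord0 i + x ord0 i * v ord0 i)).
  by apply: is_derive_sumf => i; apply: is_derive_mulf; exact: is_derive_coord.
by rewrite big_distrr; apply: eq_bigr => i _ /=; ring.
Qed.

Lemma edot_delta x i : edot x (delta_mx ord0 i) = x ord0 i.
Proof.
rewrite /edot (bigD1 i)//= mxE !eqxx mulr1 big1 ?addr0// => j ji.
by rewrite mxE (negbTE ji) andbF mulr0.
Qed.

Lemma is_derive_conformal_factor x v : hball x ->
  is_derive x v (@conformal_factor R n) (conformal_factor x ^+ 2 * edot x v).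
Proof.
move=> xb; have xb' := (hball_edot x).1 xb.
have x0 : 1 - edot x x != 0 by rewrite gt_eqF// subr_gt0.
rewrite (_ : @conformal_factor R n = fun y => 2 * (1 - edot y y)^-1);
  last first.
  by apply/funext => y; rewrite conformal_factorE.
have d := is_derive_subf (is_derive_cst (1 : R) x v) (is_derive_edot_diag x v).
have d2 := @is_derive_invf _ _ (fun y => 1 - edot y y) _ _ _ x0 d.
apply: (is_derive_eq (is_derive_mulc 2 d2)).
rewrite sub0r /=.
by field.
Qed.

Lemma partial_hmetric x i j k : hball x ->
  partial i (fun y : 'rV[R]_n => hmetric y j k) x =
  2 * conformal_factor x ^+ 3 * x ord0 i * (j == k)%:R.
Proof.
move=> xb; rewrite /partial; apply: derive_val.
rewrite (_ : (fun y => _) = fun y : 'rV[R]_n => (j == k)%:R *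
   (conformal_factor y * conformal_factor y)); last first.
  by apply/funext => y; rewrite /hmetric mxE expr2 mulr_natl.
apply: is_derive_eq.
  apply: is_derive_mulc; apply: is_derive_mulf.
    exact: is_derive_conformal_factor.
  exact: is_derive_conformal_factor.
by rewrite edot_delta; ring.
Qed.

(** The connection of a conformally flat metric depends only on the logarithmic derivative of the
    factor, and here the i-th partial derivative of log lambda is lambda x_i. *)
Lemma christoffelE x k i j : hball x -> christoffel k i j x =
  conformal_factor x * (x ord0 i * (j == k)%:R + x ord0 j * (i == k)%:R
                        - x ord0 k * (i == j)%:R).
Proof.
move=> xb; have l0 := conformal_factor_gt0 xb.
have l0' : conformal_factor x != 0 by rewrite gt_eqF.
rewrite /christoffel /hmetric invmx_scalar (bigD1 k)//= big1 ?addr0; last first.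
  by move=> l lk; rewrite mxE eq_sym (negbTE lk) mulr0n mul0r.
rewrite mxE eqxx !partial_hmetric// mulr1n.
move: (_ == k)%:R (i == k)%:R (i == j)%:R => a b c.
by field.
Qed.

Lemma christoffel_sum x v k : hball x ->
  \sum_i \sum_j christoffel k i j x * v ord0 i * v ord0 j =
  conformal_factor x * (2 * edot x v * v ord0 k - edot v v * x ord0 k).
Proof.
move=> xb.
transitivity (\sum_i (conformal_factor x * (x ord0 i * v ord0 i * v ord0 k
    + edot x v * (v ord0 i * (i == k)%:R) - v ord0 i * v ord0 i * x ord0 k))).
  apply: eq_bigr => i _.
  transitivity (\sum_j (conformal_factor x * (x ord0 i * v ord0 i * (v ord0 j *
    (j == k)%:R)
     + (x ord0 j * v ord0 j) * (v ord0 i * (i == k)%:R)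
     - v ord0 i * x ord0 k * (v ord0 j * (j == i)%:R)))).
    apply: eq_bigr => j _; rewrite christoffelE// (eq_sym j i).
    by move: (j == k)%:R (i == k)%:R (i == j)%:R => a b c; ring.
  rewrite -mulr_sumr sumrB big_split/= -!mulr_sumr -mulr_suml; congr (_ * _).
  have pick l : \sum_j v ord0 j * (j == l)%:R = v ord0 l.
    rewrite (bigD1 l)//= eqxx mulr1 big1 ?addr0// => j /negbTE ->.
    by rewrite mulr0.
  rewrite !pick -/(edot x v); move: (i == k)%:R (edot x v) => a b; ring.
rewrite -mulr_sumr sumrB big_split/= -!mulr_suml -mulr_sumr; congr (_ * _).
rewrite (_ : \sum_i v ord0 i * _ = v ord0 k); last first.
  rewrite (bigD1 k)//= eqxx mulr1 big1 ?addr0// => j /negbTE ->.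
  by rewrite mulr0.
rewrite -/(edot x v) -/(edot v v); move: (edot x v) (edot v v) => a b; ring.
Qed.

End christoffel.

(** * Uniqueness of geodesics *)

Section curves.
Context {R : realType} {n : nat}.
Implicit Types (gam u w : R -> 'rV[R]_n).

Lemma is_derive_row u (t : R) (du : 'rV[R]_n) :
  is_derive t 1 u du <->
  forall k, is_derive t 1 (fun s => u s ord0 k) (du ord0 k).
Proof.
split=> [[hu <-] k|h].
  by apply: DeriveDef; [exact: (derivable_mxP _ _ _).1|rewrite derive_mx// mxE].
have hu : derivable u t 1.
  by apply/derivable_mxP => i j; rewrite ord1;
    exact: @ex_derive _ _ _ _ _ _ _ (h j).
apply: DeriveDef => //; rewrite derive_mx//.
by apply/rowP => k; rewrite mxE; exact: @derive_val _ _ _ _ _ _ _ (h k).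
Qed.

Lemma is_derive_edot u w (t : R) (du dw : 'rV[R]_n) :
  is_derive t 1 u du -> is_derive t 1 w dw ->
  is_derive t 1 (fun s => edot (u s) (w s)) (edot du (w t) + edot (u t) dw).
Proof.
move=> /is_derive_row hu /is_derive_row hw.
rewrite /edot -big_split; apply: is_derive_sumf => k.
exact: is_derive_mulf (hu k) (hw k).
Qed.

Lemma is_derive_conformal_comp u (t : R) (du : 'rV[R]_n) : hball (u t) ->
  is_derive t 1 u du ->
  is_derive t 1 (fun s => conformal_factor (u s))
    (conformal_factor (u t) ^+ 2 * edot (u t) du).
Proof.
move=> /hball_edot u1 hu.
have u0 : 1 - edot (u t) (u t) != 0 by rewrite gt_eqF// subr_gt0.
rewrite (_ : (fun s => conformal_factor (u s)) =
    fun s => 2 * (1 - edot (u s) (u s))^-1); last first.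
  by apply/funext => s; rewrite conformal_factorE.
have d := is_derive_subf (is_derive_cst (1 : R) t 1) (is_derive_edot hu hu).
have d2 := @is_derive_invf _ _ (fun s => 1 - edot (u s) (u s)) _ _ _ u0 d.
apply: (is_derive_eq (is_derive_mulc 2 d2)).
rewrite sub0r conformal_factorE (edotC du) /=.
by field.
Qed.

(** Minus the Christoffel quadratic form of [christoffel_sum], as a vector: the geodesic equation
    reads x'' = [geodesic_acc] x x'. *)
Definition geodesic_acc (x v : 'rV[R]_n) : 'rV[R]_n :=
  conformal_factor x *: (edot v v *: x - (2 * edot x v) *: v).

Lemma is_geodesicP gam : is_geodesic gam <->
  exists2 v : R -> 'rV[R]_n, derive1 gam = v &
    forall t : R, [/\ hball (gam t), is_derive t 1 gam (v t) &
      is_derive t 1 v (geodesic_acc (gam t) (v t))].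
Proof.
split=> [h|[v gv h] t].
  exists (derive1 gam); first by [].
  move=> t; have [xb d1 d2 e] := h t; split; first exact: xb.
    by rewrite derive1E; exact: derivableP d1.
  apply: (is_derive_eq (derivableP d2)); apply/rowP => k.
  have /eqP := e k; rewrite christoffel_sum// addr_eq0 derive1nS derive1n1
    derive1E.
  by move=> /eqP ->; rewrite /geodesic_acc !mxE; ring.
have [xb d1 d2] := h t; split => [//||| k].
- exact: (@ex_derive _ _ _ _ _ _ _ d1).
- by rewrite gv; exact: (@ex_derive _ _ _ _ _ _ _ d2).
rewrite christoffel_sum// derive1nS derive1n1 gv derive1E
  (@derive_val _ _ _ _ _ _ _ d2).
by rewrite /geodesic_acc !mxE; ring.
Qed.

End curves.

Section geodesic_uniqueness.
Context {R : realType}.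

(** The operator D^2 - c^2 factors as (D + c)(D - c): (z' - c z) e^{ct} is constant, hence zero, and
    then z e^{-ct} is constant too. The argument includes c = 0, the case of constant geodesics. *)
Lemma linear_ode2_eq0 (c : R) (z z' : R -> R) :
  (forall t : R, is_derive t 1 z (z' t)) ->
  (forall t : R, is_derive t 1 z' (c ^+ 2 * z t)) ->
  z 0 = 0 -> z' 0 = 0 -> forall t, z t = 0.
Proof.
move=> hz hz' z0 z'0.
have he (a t : R) : is_derive t 1 (fun s : R => expR (a * s)) (a * expR
  (a * t)).
  apply: (is_derive_eq (is_derive1_comp (is_derive_expR _)
    (is_derive_mulc a (is_derive_id t 1)))).
  by rewrite mulr1 mulrC.
have w0 t : z' t = c * z t.
  pose w s := (z' s - c * z s) * expR (c * s).
  suff : w t = w 0.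
    rewrite /w z0 z'0 mulr0 subrr mul0r => /eqP; rewrite mulf_eq0.
    by rewrite (gt_eqF (expR_gt0 _)) orbF subr_eq0 => /eqP.
  apply: is_derive_0_is_cst => s; rewrite /w.
  apply: (is_derive_eq (is_derive_mulf (is_derive_subf (hz' s)
    (is_derive_mulc c (hz s))) (he c s))).
  by rewrite /GRing.scale/=; ring.
move=> t; pose w s := z s * expR (- c * s).
suff : w t = w 0.
  rewrite /w z0 mul0r => /eqP; rewrite mulf_eq0.
  by rewrite (gt_eqF (expR_gt0 _)) orbF => /eqP.
apply: is_derive_0_is_cst => s; rewrite /w.
apply: (is_derive_eq (is_derive_mulf (hz s) (he (- c) s))).
by rewrite w0 /GRing.scale/=; ring.
Qed.

Context {n : nat}.
Implicit Types (gam : R -> 'rV[R]_n).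

Definition speed2 (x v : 'rV[R]_n) : R := conformal_factor x ^+ 2 * edot v v.

Lemma conformal_factor_edot (x : 'rV[R]_n) : hball x ->
  conformal_factor x * (1 - edot x x) = 2.
Proof.
move=> /hball_edot x1; rewrite conformal_factorE divfK//.
by rewrite gt_eqF// subr_gt0.
Qed.

Lemma geodesic_speed2 gam : is_geodesic gam ->
  forall t, speed2 (gam t) (derive1 gam t) = speed2 (gam 0) (derive1 gam 0).
Proof.
move=> /is_geodesicP[v -> h] t.
apply: (@is_derive_0_is_cst _ (fun s => speed2 (gam s) (v s))) => s.
have [xb d1 d2] := h s.
have dl := is_derive_conformal_comp xb d1; rewrite /speed2.
apply: (is_derive_eq (is_derive_mulf (is_derive_sqrf dl)
  (is_derive_edot d2 d2))).
rewrite /= /geodesic_acc !edotE (edotC (v s) (gam s)).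
by ring.
Qed.

(* With [l] the conformal factor along [gam], [l - 1] and [l *: gam] are the
   coordinates of the lift of [gam] to the hyperboloid. *)
Lemma geodesic_lift gam (v : R -> 'rV[R]_n) (c : R) :
  (forall t : R, [/\ hball (gam t), is_derive t 1 gam (v t) &
      is_derive t 1 v (geodesic_acc (gam t) (v t))]) ->
  (forall t : R, speed2 (gam t) (v t) = c ^+ 2) ->
  [/\ forall t : R, is_derive t 1 (fun s => conformal_factor (gam s))
        (conformal_factor (gam t) ^+ 2 * edot (gam t) (v t)),
      forall t : R, is_derive t 1
        (fun s => conformal_factor (gam s) ^+ 2 * edot (gam s) (v s))
        (c ^+ 2 * (conformal_factor (gam t) - 1)),
      forall k (t : R), is_derive t 1
        (fun s => conformal_factor (gam s) * gam s ord0 k)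
        (conformal_factor (gam t) ^+ 2 * edot (gam t) (v t) * gam t ord0 k +
         conformal_factor (gam t) * v t ord0 k) &
      forall k (t : R), is_derive t 1
        (fun s => conformal_factor (gam s) ^+ 2 * edot (gam s)
          (v s) * gam s ord0 k +
         conformal_factor (gam s) * v s ord0 k)
        (c ^+ 2 * (conformal_factor (gam t) * gam t ord0 k))].
Proof.
move=> h hc.
have dl (t : R) : is_derive t 1 (fun s => conformal_factor (gam s))
        (conformal_factor (gam t) ^+ 2 * edot (gam t) (v t)).
  by have [xb d1 d2] := h t; exact: is_derive_conformal_comp.
have db (t : R) : is_derive t 1
        (fun s => conformal_factor (gam s) ^+ 2 * edot (gam s) (v s))
        (c ^+ 2 * (conformal_factor (gam t) - 1)).
  have [xb d1 d2] := h t;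
    apply: (is_derive_eq (is_derive_mulf (is_derive_sqrf (dl t))
      (is_derive_edot d1 d2))).
  rewrite /= /geodesic_acc !edotE -(hc t) /speed2.
  have := conformal_factor_edot xb.
  set l := conformal_factor _; set a := edot (gam t) (gam t) => la.
  (* Since l (1 - |gam|^2) = 2, this form of the constant 1 lets [ring] close the goal. *)
  have -> : 1 = l * (1 - a) - 1 by rewrite la; ring.
  by ring.
split => // k t; have [xb /is_derive_row/(_ k) d1 /is_derive_row/(_ k) d2] :=
  h t.
  exact: is_derive_mulf.
apply: (is_derive_eq (is_derive_addf (is_derive_mulf (db t) d1) (is_derive_mulf
  (dl t) d2))).
rewrite /= -(hc t) /speed2 /geodesic_acc !mxE; ring.
Qed.

(** Both curves have the same speed c, and the differences of the coordinates of their lifts solve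
    z'' = c^2 z with zero data. The time coordinate gives equal conformal factors, which then cancel
    from the space coordinates. *)
Lemma geodesic_unique gam1 gam2 : is_geodesic gam1 -> is_geodesic gam2 ->
  gam1 0 = gam2 0 -> derive1 gam1 0 = derive1 gam2 0 -> gam1 = gam2.
Proof.
move=> g1 g2 e0 e1.
pose c := Num.sqrt (speed2 (gam1 0) (derive1 gam1 0)).
have c2 : c ^+ 2 = speed2 (gam1 0) (derive1 gam1 0).
  by rewrite sqr_sqrtr// mulr_ge0 ?sqr_ge0 ?edot_ge0.
have c1 t : speed2 (gam1 t) (derive1 gam1 t) = c ^+ 2 by
  rewrite c2 geodesic_speed2.
have {c2} c2 t : speed2 (gam2 t) (derive1 gam2 t) = c ^+ 2.
  by rewrite c2 e0 e1 geodesic_speed2.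
move/is_geodesicP : g1 c1 e1 => [v1 -> h1] c1 e1.
move/is_geodesicP : g2 c2 e1 => [v2 -> h2] c2 e1.
have [dl1 db1 dg1 dw1] := geodesic_lift h1 c1.
have [dl2 db2 dg2 dw2] := geodesic_lift h2 c2.
have lE t : conformal_factor (gam1 t) = conformal_factor (gam2 t).
  apply/eqP; rewrite -subr_eq0; apply/eqP; move: t.
  apply: (linear_ode2_eq0 (c := c) (fun t => is_derive_subf (dl1 t) (dl2 t))).
  - move=> t; apply: (is_derive_eq (is_derive_subf (db1 t) (db2 t))).
    by rewrite /=; ring.
  - by rewrite e0 subrr.
  - by rewrite /= e0 e1 subrr.
apply/funext => t; apply/rowP => k.
have l0 : conformal_factor (gam1 t) != 0.
  by have [xb _ _] := h1 t; rewrite gt_eqF// conformal_factor_gt0.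
apply: (mulfI l0); rewrite [in RHS]lE.
apply/eqP; rewrite -subr_eq0; apply/eqP; move: t {l0}.
apply: (linear_ode2_eq0 (c := c) (fun t => is_derive_subf (dg1 k t) (dg2 k t))).
- move=> t; apply: (is_derive_eq (is_derive_subf (dw1 k t) (dw2 k t))).
  by rewrite /=; ring.
- by rewrite e0 subrr.
- by rewrite /= e0 e1 subrr.
Qed.

End geodesic_uniqueness.

(** * Explicit geodesics and their endpoints *)

Section explicit_geodesics.
Context {R : realType} {n : nat}.
Implicit Types (x V u P Q : 'rV[R]_n) (p r c t : R).

(* [hgeo] is [Y / (1 + X)] for [X = p e^ct + r e^-ct] and
   [Y = e^ct P + e^-ct Q]; [hgeo_param] puts [(X, Y)] on the sheet [X > 0] of
   the hyperboloid [X^2 - |Y|^2 = 1]. *)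
Definition hgeo P Q p r c t : 'rV[R]_n :=
  (1 + p * expR (c * t) + r * expR (- (c * t)))^-1 *:
  (expR (c * t) *: P + expR (- (c * t)) *: Q).

Definition hgeo_velocity P Q p r c t : 'rV[R]_n :=
  let e := expR (c * t) in let f := expR (- (c * t)) in
  let a := 1 + p * e + r * f in
  (c / a ^+ 2) *: (a *: (e *: P - f *: Q) - (p * e - r * f) *:
    (e *: P + f *: Q)).

(** (p, P) and (r, Q) are null vectors of Lorentz product p r - <P, Q> = 1/2. In particular P/p and
    Q/r are unit vectors: they are the endpoints of the curve. *)
Definition hgeo_param P Q p r : Prop :=
  [/\ 0 < p, 0 < r, edot P P = p ^+ 2, edot Q Q = r ^+ 2 &
      edot P Q = p * r - 2^-1].

Lemma is_derive_expRc c t :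
  is_derive t 1 (fun s => expR (c * s)) (c * expR (c * t)).
Proof.
apply: (is_derive_eq (is_derive1_comp (is_derive_expR _)
  (is_derive_mulc c (is_derive_id t 1)))).
by rewrite mulr1 mulrC.
Qed.

Lemma is_derive_expRNc c t :
  is_derive t 1 (fun s => expR (- (c * s))) (- (c * expR (- (c * t)))).
Proof.
have := is_derive_expRc (- c) t; rewrite !mulNr.
by under eq_fun do rewrite mulNr.
Qed.

Section fixed_parameters.
Variables (P Q : 'rV[R]_n) (p r : R).
Hypothesis PQ : hgeo_param P Q p r.

Let p0 : 0 < p. Proof. by case: PQ. Qed.
Let r0 : 0 < r. Proof. by case: PQ. Qed.

(** Absorbs a translation of time into the parameters. The ratios P/p and Q/r are unchanged, which
    is why endpoints are invariant under the flow. *)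
Lemma hgeo_shift t0 : hgeo_param (expR t0 *: P) (expR (- t0) *: Q)
  (p * expR t0) (r * expR (- t0)).
Proof.
have [_ _ PP QQ E] := PQ; split; rewrite ?mulr_gt0 ?expR_gt0// !edotE.
- by rewrite PP; ring.
- by rewrite QQ; ring.
- by have := expRxMexpNx_1 t0; rewrite E; nra.
Qed.

(** With a = 1 + X, and derivatives X', Y' taken in the variable ct, the hyperboloid relation gives
    |Y|^2 = X^2 - 1, <Y, Y'> = X X' and |Y'|^2 = X'^2 + 1. The value of |x|^2 means that a is the
    conformal factor at x. *)
Lemma hgeo_facts c t : let e := expR (c * t) in let f := expR (- (c * t)) in
  let a := 1 + p * e + r * f in
  let x := hgeo P Q p r c t in let v := hgeo_velocity P Q p r c t in
  [/\ 0 < a, edot x x = (a - 2) / a, edot x v = c * (p * e - r * f) / a ^+ 2 &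
      edot v v = c ^+ 2 / a ^+ 2].
Proof.
move=> e f a x v; have [_ _ PP QQ E] := PQ.
have ef : e * f = 1 by exact: expRxMexpNx_1.
have e0 : 0 < e := expR_gt0 _; have f0 : 0 < f := expR_gt0 _.
have a0 : 0 < a by rewrite !addr_gt0// mulr_gt0.
have a0' : a != 0 by rewrite gt_eqF.
pose a1 := p * e - r * f; pose b := e *: P + f *: Q; pose b1 := e *: P - f *: Q.
have bb : edot b b = a ^+ 2 - 2 * a.
  rewrite /b !edotE (edotC Q) PP QQ E /a.
  by transitivity (p ^+ 2 * e ^+ 2 + r ^+ 2 * f ^+ 2 + 2 * p * r * (e * f) -
    (e * f));
    [field|ring: ef].
have bb1 : edot b b1 = (a - 1) * a1.
  by rewrite /b /b1 !edotE (edotC Q) PP QQ E /a /a1; ring.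
have b1b1 : edot b1 b1 = a1 ^+ 2 + 1.
  rewrite /b1 !edotE (edotC Q) PP QQ E /a1.
  by transitivity (p ^+ 2 * e ^+ 2 + r ^+ 2 * f ^+ 2 - 2 * p * r * (e * f) +
    (e * f));
    [field|ring: ef].
have -> : x = a^-1 *: b by [].
have -> : v = (c / a ^+ 2) *: (a *: b1 - a1 *: b) by [].
rewrite -/a1; clearbody b b1 a1; split => //.
- by rewrite !edotE bb; field.
- by rewrite !edotE bb bb1; field.
- by rewrite !edotE (edotC b1 b) bb bb1 b1b1; field.
Qed.

Lemma is_derive_hgeo c t :
  is_derive t 1 (hgeo P Q p r c) (hgeo_velocity P Q p r c t).
Proof.
apply/is_derive_row => k.
have [a0 _ _ _] := hgeo_facts c t.
have de := is_derive_expRc c t; have df := is_derive_expRNc c t.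
have d1 := is_derive_addf (is_derive_mulf (is_derive_cst p t 1) de)
  (is_derive_mulf (is_derive_cst r t 1) df).
have a0' : cst 1 t + (cst p t * expR (c * t) + cst r t * expR (- (c * t))) != 0.
  by rewrite addrA gt_eqF.
have d2 := @is_derive_invf _ _ (fun s => cst 1 s + (cst p s * expR
  (c * s) + cst r s * expR (- (c * s)))) _ _ _ a0'
  (is_derive_addf (is_derive_cst (1 : R) t 1) d1).
have d3 := is_derive_addf (is_derive_mulf de (is_derive_cst (P ord0 k) t 1))
  (is_derive_mulf df (is_derive_cst (Q ord0 k) t 1)).
have := is_derive_mulf d2 d3.
rewrite (_ : (fun _ => _) = (fun s => hgeo P Q p r c s ord0 k)); last first.
  by apply/funext => s; rewrite /hgeo /= !mxE addrA.
move=> d4; apply: (is_derive_eq d4).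
rewrite /hgeo_velocity !mxE /= {d1 d2 d3 d4 de df}; move: a0' => /=;
  rewrite addrA.
move: (expR _) (expR _) => e f a0'.
by field.
Qed.

Lemma is_derive_hgeo_velocity c t :
  is_derive t 1 (hgeo_velocity P Q p r c)
    (geodesic_acc (hgeo P Q p r c t) (hgeo_velocity P Q p r c t)).
Proof.
apply/is_derive_row => k.
have [a0 xx xv vv] := hgeo_facts c t.
have de := is_derive_expRc c t; have df := is_derive_expRNc c t.
have d1 := is_derive_addf (is_derive_mulf (is_derive_cst p t 1) de)
  (is_derive_mulf (is_derive_cst r t 1) df).
have d1' := is_derive_subf (is_derive_mulf (is_derive_cst p t 1) de)
  (is_derive_mulf (is_derive_cst r t 1) df).
have a0' : cst 1 t + (cst p t * expR (c * t) + cst r t * expR (- (c * t))) != 0.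
  by rewrite addrA gt_eqF.
have da := is_derive_addf (is_derive_cst (1 : R) t 1) d1.
have d2 := @is_derive_invf _ _ (fun s => cst 1 s + (cst p s * expR
  (c * s) + cst r s * expR (- (c * s)))) _ _ _ a0' da.
have d3 := is_derive_addf (is_derive_mulf de (is_derive_cst (P ord0 k) t 1))
  (is_derive_mulf df (is_derive_cst (Q ord0 k) t 1)).
have d3' := is_derive_subf (is_derive_mulf de (is_derive_cst (P ord0 k) t 1))
  (is_derive_mulf df (is_derive_cst (Q ord0 k) t 1)).
have := is_derive_mulf (is_derive_mulc c (is_derive_sqrf d2))
  (is_derive_subf (is_derive_mulf da d3') (is_derive_mulf d1' d3)).
rewrite (_ : (fun _ => _) = (fun s => hgeo_velocity P Q p r c s ord0 k));
  last first.
  by apply/funext => s; rewrite /hgeo_velocity /= !mxE addrA exprVn.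
move=> d4; apply: (is_derive_eq d4).
rewrite /geodesic_acc conformal_factorE xx xv vv /hgeo /hgeo_velocity !mxE /=.
rewrite {d1 d1' d2 d3 d3' d4 de df da xx xv vv}; move: a0' a0 => /=;
  rewrite !addrA.
move: (expR _) (expR _) => f e a0' a0.
set a := 1 + p * e + r * f in a0' a0 *.
rewrite (_ : 1 - (a - 2) / a = 2 / a); last by field.
by rewrite /a in a0' *; field.
Qed.

End fixed_parameters.
End explicit_geodesics.

Section geodesic_endpoints.
Context {R : realType} {n : nat}.
Implicit Types (x V u P Q : 'rV[R]_n) (p r c t : R).

(** Uniqueness identifies the curve selected by [get] with any known geodesic having the same
    initial data. *)
Lemma geodesicE (gam : R -> 'rV[R]_n) : is_geodesic gam ->
  geodesic (gam 0) (derive1 gam 0) = gam.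
Proof.
move=> g; rewrite /geodesic.
have [g' e0 e1] := @getPex _ [set h | [/\ is_geodesic h, h 0 = gam 0 &
  derive1 h 0 = derive1 gam 0]] (ex_intro _ gam (And3 g erefl erefl)).
exact: geodesic_unique.
Qed.

(** Serves the zero section, on which a direction and endpoints at infinity make no sense. *)
Lemma geodesic0 x : hball x -> geodesic x 0 = cst x.
Proof.
move=> xb; have d (t : R) : is_derive t 1 (cst x) (0 : 'rV[R]_n).
  exact: is_derive_cst.
have d0 : derive1 (cst x) = cst (0 : 'rV[R]_n) :> (R -> 'rV[R]_n).
  by apply/funext => t; rewrite derive1E (@derive_val _ _ _ _ _ _ _ (d t)).
have g : is_geodesic (cst x).
  apply/is_geodesicP; exists (cst 0) => // t; split => //.
  apply: (is_derive_eq (is_derive_cst (0 : 'rV[R]_n) t 1)).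
  by rewrite /geodesic_acc scaler0 subr0 /edot big1 ?scale0r ?scaler0// => i _;
    rewrite mxE mul0r.
by have := geodesicE g; rewrite d0.
Qed.

Lemma cvg_expRNc c : 0 < c -> expR (- (c * t)) @[t --> +oo] --> (0 : R).
Proof.
move=> c0; apply: (cvg_comp (fun t => c * t) (fun s => expR (- s)) _
  (@cvgr_expR R)).
by apply: gt0_cvgMry => //; exact: cvg_id.
Qed.

Section fixed_parameters.
Variables (P Q : 'rV[R]_n) (p r c : R).
Hypothesis PQ : hgeo_param P Q p r.
Hypothesis c0 : 0 < c.
Local Notation gam := (hgeo P Q p r c).
Local Notation vel := (hgeo_velocity P Q p r c).

Lemma hball_hgeo t : hball (gam t).
Proof.
have [a0 xx _ _] := hgeo_facts PQ c t.
by apply/hball_edot; rewrite xx ltr_pdivrMr// mul1r gtrBl.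
Qed.

Lemma derive1_hgeo : derive1 gam = vel.
Proof.
apply/funext => t.
by rewrite derive1E (@derive_val _ _ _ _ _ _ _ (is_derive_hgeo PQ c t)).
Qed.

Lemma is_geodesic_hgeo : is_geodesic gam.
Proof.
apply/is_geodesicP; exists vel; first exact: derive1_hgeo.
move=> t; split; first exact: hball_hgeo.
- exact: is_derive_hgeo.
- exact: is_derive_hgeo_velocity.
Qed.

Lemma geodesic_hgeo : geodesic (gam 0) (vel 0) = gam.
Proof. by rewrite -derive1_hgeo; apply: geodesicE; exact: is_geodesic_hgeo. Qed.

Lemma hnorm_hgeo t : hnorm (gam t) (vel t) = c.
Proof.
have [a0 xx xv vv] := hgeo_facts PQ c t.
rewrite hnormE; last exact: hball_hgeo.
rewrite conformal_factorE enormE xx vv -expr_div_n sqrtr_sqr gtr0_norm;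
  last first.
  exact: divr_gt0.
by field; rewrite gt_eqF//=; apply/eqP; lra.
Qed.

Lemma cvg_hgeo_pinfty : gam t @[t --> +oo] --> p^-1 *: P.
Proof.
have [p0 r0 _ _ _] := PQ.
(* Numerator and denominator are multiplied by e^{-ct}, so that only decaying exponentials
   remain. *)
rewrite (_ : gam = fun t => (expR (- (c * t)) + p + r * (expR (- (c * t)) * expR
  (- (c * t))))^-1 *:
    (P + (expR (- (c * t)) * expR (- (c * t))) *: Q)); last first.
  apply/funext => t; rewrite /hgeo.
  have [a0 _ _ _] := hgeo_facts PQ c t; move: a0 => /=.
  have := expRxMexpNx_1 (c * t); have := expR_gt0 (- (c * t)).
  move: (expR (c * t)) (expR (- (c * t))) => e f f0 ef a0.
  have -> : f + p + r * (f * f) = f * (1 + p * e + r * f) by ring: ef.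
  have fe : f^-1 = e by rewrite -[RHS](mulfK (lt0r_neq0 f0)) ef mul1r.
  rewrite invfM fe [in RHS]mulrC -[RHS]scalerA; congr (_ *: _).
  by rewrite scalerDr scalerA mulrA ef mul1r.
have e0 := cvg_expRNc c0.
have -> : p^-1 *: P = (0 + p + r * (0 * 0))^-1 *: (P + (0 * 0) *: Q).
  by rewrite !mulr0 scale0r add0r !addr0.
apply: cvgZ.
  apply: cvgV; first by rewrite !mulr0 add0r addr0 gt_eqF.
  apply: cvgD; first by apply: cvgD => //; exact: cvg_cst.
  by apply: cvgM; [exact: cvg_cst|exact: cvgM].
apply: cvgD; first exact: cvg_cst.
by apply: cvgZr_tmp; exact: cvgM.
Qed.


End fixed_parameters.

Lemma hgeo_sym P Q p r c t : hgeo P Q p r c t = hgeo Q P r p c (- t).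
Proof.
by rewrite /hgeo mulrN opprK addrAC [X in _ *: X]addrC.
Qed.

Lemma hgeo_param_sym P Q p r : hgeo_param P Q p r -> hgeo_param Q P r p.
Proof. by move=> [? ? ? ? E]; split=> //; rewrite edotC E mulrC. Qed.

Lemma cvg_hgeo_ninfty P Q p r c : hgeo_param P Q p r -> 0 < c ->
  hgeo P Q p r c t @[t --> -oo] --> r^-1 *: Q.
Proof.
move=> /hgeo_param_sym QP c0; apply/cvgNy_compNP.
rewrite (_ : _ \o _ = hgeo Q P r p c); first exact: cvg_hgeo_pinfty.
by apply/funext => t /=; rewrite hgeo_sym opprK.
Qed.

(** [hgeo_shift] by ct makes the point at time t the origin of time, so the limits already computed
    from time 0 apply at every t. *)
Lemma hgeo_ends P Q p r c t : hgeo_param P Q p r -> 0 < c ->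
  let x := hgeo P Q p r c t in let v := hgeo_velocity P Q p r c t in
  [/\ v != 0, geodesic x v = fun s => hgeo P Q p r c (t + s),
      hnorm x v = c, sigma_minus x v = r^-1 *: Q & sigma_plus x v = p^-1 *: P].
Proof.
move=> PQ c0 x v.
have PQt := hgeo_shift PQ (c * t).
have gE s : hgeo (expR (c * t) *: P) (expR (- (c * t)) *: Q)
    (p * expR (c * t)) (r * expR (- (c * t))) c s = hgeo P Q p r c (t + s).
  by rewrite /hgeo !scalerA mulrDr opprD !expRD !mulrA
    ![expR (c * s) * _]mulrC ![expR (- (c * s)) * _]mulrC.
have xE := gE 0; rewrite addr0 in xE.
have vE : hgeo_velocity (expR (c * t) *: P) (expR (- (c * t)) *: Q)
    (p * expR (c * t)) (r * expR (- (c * t))) c 0 = v.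
  by rewrite /v /hgeo_velocity !mulr0 oppr0 expR0 !scale1r !mulr1.
have geoE := geodesic_hgeo c PQt.
rewrite xE vE -/x in geoE.
have hv : hnorm x v = c by exact: hnorm_hgeo.
have [p0 r0 _ _ _] := PQ.
split => //.
- apply/eqP => v0; move: c0; rewrite -hv v0 hnormE; last exact: hball_hgeo.
  by rewrite (_ : enorm 0 = 0) ?mulr0 ?ltxx//; apply/eqP; rewrite enorm_eq0.
- by rewrite geoE; apply/funext => s; rewrite gE.
- rewrite /sigma_minus geoE; apply: cvg_lim => //.
  rewrite (_ : r^-1 *: Q = (r * expR (- (c * t)))^-1 *: (expR (-
    (c * t)) *: Q)).
    exact: cvg_hgeo_ninfty.
  by rewrite scalerA invfM mulfVK// gt_eqF// expR_gt0.
- rewrite /sigma_plus geoE; apply: cvg_lim => //.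
  rewrite (_ : p^-1 *: P = (p * expR (c * t))^-1 *: (expR (c * t) *: P)).
    exact: cvg_hgeo_pinfty.
  by rewrite scalerA invfM mulfVK// gt_eqF// expR_gt0.
Qed.

(* The final point at infinity of the geodesic issued from [x] in the Euclidean
   unit direction [u]; the initial one is [endpoint x (- u)]. *)
Definition endpoint x u : 'rV[R]_n :=
  (conformal_factor x * (1 + edot x u) - 1)^-1 *:
  ((conformal_factor x * (1 + edot x u)) *: x + u).

(** [hP] and [hp] are half the sum of position and unit-speed velocity on the hyperboloid. Position
    is (lambda - 1, lambda x), and velocity is (lambda <x, u>, lambda <x, u> x + u). Changing u into
    -u gives half the difference. *)
Let hP x u := 2^-1 *: ((conformal_factor x * (1 + edot x u)) *: x + u).
Let hp x u := (conformal_factor x * (1 + edot x u) - 1) / 2.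

(** The quantity equals lambda |x + u|^2 / 2, and x is not -u because |x| < 1 = |u|. *)
Lemma endpoint_denom_gt0 x u : hball x -> edot u u = 1 ->
  0 < conformal_factor x * (1 + edot x u) - 1.
Proof.
move=> xb u1; have l0 := conformal_factor_gt0 xb;
  have lE := conformal_factor_edot xb.
have xu : 0 < edot (x + u) (x + u).
  rewrite lt0r edot_ge0 andbT edot_eq0 addr_eq0; apply/eqP => xu.
  by move/hball_edot : xb; rewrite xu edotNl edotNr opprK u1 ltxx.
have : 0 < conformal_factor x * edot (x + u) (x + u) by exact: mulr_gt0.
rewrite !edotE u1 (edotC u x); nra.
Qed.

Lemma hgeo_param_tangent x u : hball x -> edot u u = 1 ->
  hgeo_param (hP x u) (hP x (- u)) (hp x u) (hp x (- u)).
Proof.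
move=> xb u1; have lE := conformal_factor_edot xb.
have u1' : edot (- u) (- u) = 1 by rewrite edotNl edotNr opprK.
split; rewrite /hP /hp; first by rewrite divr_gt0// endpoint_denom_gt0.
- by rewrite divr_gt0// endpoint_denom_gt0.
- rewrite !edotE (edotC u x) u1.
  move: (conformal_factor x) (edot x x) (edot x u) lE => l a s lE.
  (* In terms of b = 1 - |x|^2 the defining relation of lambda becomes l b = 2, a form that [field]
     can use as a rewriting rule. *)
  have -> : a = 1 - (1 - a) by ring.
  move: (1 - a) lE => b lE.
  by field: lE.
- rewrite !edotE (edotC u x) u1.
  move: (conformal_factor x) (edot x x) (edot x u) lE => l a s lE.
  have -> : a = 1 - (1 - a) by ring.
  move: (1 - a) lE => b lE.
  by field: lE.
- rewrite !edotE (edotC u x) u1.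
  move: (conformal_factor x) (edot x x) (edot x u) lE => l a s lE.
  have -> : a = 1 - (1 - a) by ring.
  move: (1 - a) lE => b lE.
  by field: lE.
Qed.

Lemma esphere_endpoint x u : hball x -> esphere R n u -> esphere R n
  (endpoint x u).
Proof.
move=> xb /esphere_edot u1; have [p0 _ PP _ _] := hgeo_param_tangent xb u1.
apply/esphere_edot.
rewrite (_ : endpoint x u = (hp x u)^-1 *: hP x u).
  by rewrite edotZl edotZr PP; field; rewrite gt_eqF.
by rewrite /endpoint /hp /hP scalerA; congr (_ *: _); field;
  rewrite gt_eqF// endpoint_denom_gt0.
Qed.

Definition edir (V : 'rV[R]_n) := (enorm V)^-1 *: V.

Lemma esphere_edir V : V != 0 -> esphere R n (edir V).
Proof.
move=> V0; rewrite /esphere/= enormZ ger0_norm ?invr_ge0 ?enorm_ge0//.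
by rewrite mulVf// enorm_eq0.
Qed.

Lemma hgeo_tangent x V : hball x -> V != 0 ->
  exists P Q p r, [/\ hgeo_param P Q p r, hgeo P Q p r (hnorm x V) 0 = x,
    hgeo_velocity P Q p r (hnorm x V) 0 = V,
    r^-1 *: Q = endpoint x (- edir V) & p^-1 *: P = endpoint x (edir V)].
Proof.
move=> xb V0; have l0 := conformal_factor_gt0 xb.
have /esphere_edot u1 := esphere_edir V0; set u := edir V in u1 *.
have u1' : edot (- u) (- u) = 1 by rewrite edotNl edotNr opprK.
have V1 : V = enorm V *: u by rewrite scalerA mulfV ?scale1r// enorm_eq0.
have eP w : edot w w = 1 -> (hp x w)^-1 *: hP x w = endpoint x w.
  move=> w1; rewrite /endpoint /hp /hP scalerA; congr (_ *: _).
  by field; rewrite gt_eqF// endpoint_denom_gt0.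
clearbody u; exists (hP x u), (hP x (- u)), (hp x u), (hp x (- u)); split.
- exact: hgeo_param_tangent.
- rewrite /hgeo /hP /hp edotNr mulr0 oppr0 expR0 !mulr1 !scale1r.
  move: (conformal_factor x) l0 (edot x u) => l l0 s.
  rewrite (_ : 1 + _ + _ = l); last by field.
  apply/rowP => k; rewrite !mxE; move: (x ord0 k) (u ord0 k) => a b.
  by field; rewrite gt_eqF.
- rewrite hnormE// /hgeo_velocity /hP /hp edotNr mulr0 oppr0 expR0 !mulr1
  !scale1r.
  rewrite [RHS]V1; move: (conformal_factor x) l0 (edot x u)
    (enorm V) => l l0 s m.
  rewrite (_ : 1 + _ + _ = l); last by field.
  apply/rowP => k; rewrite !mxE; move: (x ord0 k) (u ord0 k) => a b.
  by field; rewrite gt_eqF.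
- exact: eP.
- exact: eP.
Qed.

Lemma hnorm_gt0 x V : hball x -> V != 0 -> 0 < hnorm x V.
Proof.
by move=> xb V0; rewrite hnormE// mulr_gt0 ?enorm_gt0// conformal_factor_gt0.
Qed.

Lemma sigmaE x V : hball x -> V != 0 ->
  sigma_minus x V = endpoint x (- edir V) /\ sigma_plus x V = endpoint x
    (edir V).
Proof.
move=> xb V0; have c0 := hnorm_gt0 xb V0.
have [P [Q [p [r [PQ xE vE <- <-]]]]] := hgeo_tangent xb V0.
by have [_ _ _] := hgeo_ends 0 PQ c0; rewrite xE vE.
Qed.

(** The flow moves (x, V) along a single curve [hgeo], whose fixed parameters c, P/p and Q/r are the
    speed and the two endpoints. *)
Lemma geodesic_flow_invariants t x V : hball x -> V != 0 ->
  let q := geodesic_flow t (x, V) in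
  [/\ hball q.1, q.2 != 0, hnorm q.1 q.2 = hnorm x V,
     sigma_minus q.1 q.2 = sigma_minus x V & sigma_plus q.1 q.2 =
       sigma_plus x V].
Proof.
move=> xb V0 q; have c0 := hnorm_gt0 xb V0.
have [-> ->] := sigmaE xb V0.
have [P [Q [p [r [PQ xE vE e1 e2]]]]] := hgeo_tangent xb V0.
have qE : q = (hgeo P Q p r (hnorm x V) t, hgeo_velocity P Q p r (hnorm x V) t).
  have gE := geodesic_hgeo (hnorm x V) PQ; rewrite xE vE in gE.
  by rewrite /q /geodesic_flow gE derive1_hgeo.
have [h1 _ h2 h3 h4] := hgeo_ends t PQ c0.
by rewrite qE /=; split => //; [exact: hball_hgeo|rewrite h3|rewrite h4].
Qed.

End geodesic_endpoints.

(** * Calculus of C^1 maps *)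

Section differential_eps.
Context {R : realType} {V W : normedModType R}.
Implicit Types (f : V -> W) (x : V).

Lemma diff_eps f x : differentiable f x -> forall e, 0 < e ->
  \forall h \near (0 : V), `|f (h + x) - f x - 'd f x h| <= e * `|h|.
Proof.
move=> /diff_locally/eqaddoP fx e e0; have := fx e e0; apply: filterS => h /=.
by rewrite /= opprD addrA.
Qed.

Lemma eps_diff f x (L : {linear V -> W}) : continuous L ->
  (forall e, 0 < e ->
    \forall h \near (0 : V), `|f (h + x) - f x - L h| <= e * `|h|) ->
  differentiable f x /\ 'd f x = L :> (V -> W).
Proof.
move=> cL fx.
have fL : f \o shift x = cst (f x) + L +o_ 0 id.
  apply/eqaddoP => e e0; have := fx e e0; apply: filterS => h /=.
  by rewrite /= opprD addrA.
have dE := diff_unique cL fL; split => //.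
by apply/diff_locallyP; rewrite dE.
Qed.

Lemma near_eq_diff f g x : (\forall y \near x, f y = g y) ->
  differentiable f x -> differentiable g x /\ 'd g x = 'd f x :> (V -> W).
Proof.
move=> fg df; have fgx := nbhs_singleton fg.
have fg0 : \forall h \near 0, f (h + x) = g (h + x).
  by move: fg; rewrite (near_shift 0); apply: filterS => h /=; rewrite subr0.
apply: eps_diff; first exact: diff_continuous.
move=> e e0; have := diff_eps df e0; apply: filterS2 fg0 => h.
by rewrite fgx => ->.
Qed.

End differential_eps.

Section C1_at.
Context {R : realType}.
Implicit Types U V W : normedModType R.

(** A local form of [C1_on]: differentiability near x, continuity of the differential at x only. The
    closure rules can then be stated at a point, without carrying an open set. *)
Definition C1_at V W (f : V -> W) (x : V) : Prop :=
  (\forall y \near x, differentiable f y) /\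
  forall v, {for x, continuous (fun y => 'd f y v)}.

Lemma C1_onP V W (A : set V) (f : V -> W) : open A ->
  C1_on A f <-> forall x, A x -> C1_at f x.
Proof.
move=> oA; split=> [h x Ax|h x Ax].
  split; last by case: (h x Ax).
  have nA : nbhs x A by apply: open_nbhs_nbhs.
  by apply: filterS nA => y /h[].
by have [d c] := h x Ax; split; first exact: (nbhs_singleton d).
Qed.

Lemma C1_at_differentiable V W (f : V -> W) x : C1_at f x -> differentiable f x.
Proof. by case=> d _; exact: (nbhs_singleton d). Qed.

Lemma C1_at_continuous V W (f : V -> W) x : C1_at f x -> {for x, continuous f}.
Proof. by move=> /C1_at_differentiable; exact: differentiable_continuous. Qed.

Lemma near_eq_for_continuous (T T' : topologicalType) (f g : T -> T') x :
  (\forall y \near x, f y = g y) -> {for x, continuous f} ->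
  {for x, continuous g}.
Proof.
move=> fg; rewrite /prop_for /continuous_at -(nbhs_singleton fg).
by apply: cvg_trans; apply: near_eq_cvg; apply: filterS fg => y ->.
Qed.

Lemma near_eq_C1_at V W (f g : V -> W) x : (\forall y \near x, f y = g y) ->
  C1_at f x -> C1_at g x.
Proof.
move=> fg [df cf]; have fg2 := near_join fg.
have dE : \forall y \near x, differentiable g y /\ 'd g y = 'd f y :> (V -> W).
  by near=> y; apply: near_eq_diff; near: y.
split; first by apply: filterS dE => y [].
move=> v; apply: near_eq_for_continuous (cf v).
by apply: filterS dE => y [_ e]; rewrite e.
Unshelve. all: by end_near. Qed.

(** Lets continuity be checked on an explicit formula for the differential. *)
Lemma C1_at_from V W (f : V -> W) (L : V -> V -> W) x :
  (\forall y \near x, differentiable f y /\ 'd f y = L y :> (V -> W)) ->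
  (forall v, {for x, continuous (L ^~ v)}) -> C1_at f x.
Proof.
move=> fL cL; split; first by apply: filterS fL => y [].
move=> v; apply: near_eq_for_continuous (cL v).
by apply: filterS fL => y [_ ->].
Qed.

Lemma C1_at_linear V W (f : {linear V -> W}) x : continuous f -> C1_at f x.
Proof.
move=> cf; apply: (@C1_at_from _ _ _ (fun=> f)) => [|v].
  by apply: nearW => y; split; [exact: linear_differentiable|exact: diff_lin].
exact: cvg_cst.
Qed.

Lemma C1_at_cst V W (a : W) (x : V) : C1_at (fun=> a) x.
Proof.
apply: (@C1_at_from _ _ _ (fun=> 0)) => [|v]; last exact: cvg_cst.
by apply: nearW => y; split; [exact: differentiable_cst|exact: diff_cst].
Qed.

Lemma C1_at_id V (x : V) : C1_at id x.
Proof. by apply: (@C1_at_linear _ _ idfun) => y; exact: cvg_id. Qed.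

Lemma C1_at_fst V W (p : V * W) : C1_at fst p.
Proof. by apply: C1_at_linear => q; exact: cvg_fst. Qed.

Lemma C1_at_snd V W (p : V * W) : C1_at snd p.
Proof. by apply: C1_at_linear => q; exact: cvg_snd. Qed.

Lemma C1_at_pair U V W (f : U -> V) (g : U -> W) x :
  C1_at f x -> C1_at g x -> C1_at (fun y => (f y, g y)) x.
Proof.
move=> [df cf] [dg cg].
apply: (@C1_at_from _ _ _ (fun y v => ('d f y v, 'd g y v))) => [|v];
  last first.
  exact: cvg_pair (cf v) (cg v).
near=> y; split; first by apply: differentiable_pair; near: y.
by apply: diff_pair; near: y.
Unshelve. all: by end_near. Qed.

Lemma C1_at_add V W (f g : V -> W) x :
  C1_at f x -> C1_at g x -> C1_at (fun y => f y + g y) x.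
Proof.
move=> [df cf] [dg cg].
apply: (@C1_at_from _ _ _ (fun y v => 'd f y v + 'd g y v)) => [|v]; last first.
  exact: cvgD (cf v) (cg v).
near=> y; split; first by apply: differentiableD; near: y.
by apply: diffD; near: y.
Unshelve. all: by end_near. Qed.

Lemma C1_at_sum V W n (f : 'I_n -> V -> W) x :
  (forall i, C1_at (f i) x) -> C1_at (fun y => \sum_i f i y) x.
Proof.
elim: n f => [f _|n IH f fC].
  by under eq_fun do rewrite big_ord0; exact: C1_at_cst.
under eq_fun do rewrite big_ord_recl.
by apply: C1_at_add => //; exact: IH.
Qed.

Lemma C1_at_mul V (f g : V -> R) x :
  C1_at f x -> C1_at g x -> C1_at (fun y => f y * g y) x.
Proof.
move=> Cf Cg; have [df cf] := Cf; have [dg cg] := Cg.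
apply: (@C1_at_from _ _ _ (fun y v => f y * 'd g y v + g y * 'd f y v)) => [|v];
  last first.
  exact: (cvgD (cvgM (C1_at_continuous Cf) (cg v)) (cvgM (C1_at_continuous Cg)
    (cf v))).
near=> y; split; first by apply: differentiableM; near: y.
by apply: diffM; near: y.
Unshelve. all: by end_near. Qed.

Lemma C1_at_real (f f' : R -> R) (x : R) :
  (\forall y \near x, is_derive (y : R) 1 f (f' y)) -> {for x, continuous f'} ->
  C1_at f x.
Proof.
move=> df cf; apply: (@C1_at_from R R f (fun y v : R => v * f' y)) => [|v];
  last first.
  exact: (cvgM (cvg_cst v) cf).
apply: filterS df => y [d1 d2]; split; first exact/derivable1_diffP.
by rewrite deriv1E// derive1E d2.
Qed.

(** Finite dimension in the form used below: every vector is a combination of finitely many fixed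
    ones, with coefficients depending continuously on it. *)
Definition finite_basis V : Prop := exists (I : finType) (e : I -> V)
  (c : I -> V -> R),
  (forall i, continuous (c i)) /\ forall v, v = \sum_i c i v *: e i.

Lemma finite_basis_rV n : finite_basis 'rV[R]_n.
Proof.
exists 'I_n, (fun i => delta_mx ord0 i), (fun i (v : 'rV[R]_n) => v ord0 i).
by split => [i|v]; [exact: coord_continuous|exact: row_sum_delta].
Qed.

Lemma finite_basis_R : finite_basis R.
Proof.
exists 'I_1, (fun=> 1), (fun _ v => v); split => [i v|v]; first exact: cvg_id.
by rewrite big_ord1 /GRing.scale/= mulr1.
Qed.

Lemma finite_basis_pair V W : finite_basis V -> finite_basis W ->
  finite_basis (V * W)%type.
Proof.
move=> [I [e [c [cc ce]]]] [J [e' [c' [cc' ce']]]].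
exists (I + J)%type, (fun k => match k with inl i => (e i, 0) | inr j =>
  (0, e' j) end),
  (fun k v => match k with inl i => c i v.1 | inr j => c' j v.2 end).
split => [[i|j] v|[v w]].
- by apply: (@continuous_comp _ _ _ fst); [exact: cvg_fst|exact: cc].
- by apply: (@continuous_comp _ _ _ snd); [exact: cvg_snd|exact: cc'].
have f1 K (F : K -> V * W) (r : seq K) :
    (\sum_(k <- r) F k) = (\sum_(k <- r) (F k).1, \sum_(k <- r) (F k).2).
  by elim: r => [|k r IH]; rewrite ?big_nil// !big_cons IH; case: (F k).
rewrite big_sumType !f1 /= [in LHS](ce v) [in LHS](ce' w).
rewrite [X in _ = (_, X) + _]big1 => [|i _]; last exact: scaler0.
rewrite [X in _ = _ + (X, _)]big1 => [|i _]; last exact: scaler0.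
by congr pair; rewrite ?addr0 ?add0r.
Qed.

(* Finite dimension of [V] makes ['d g y v] jointly continuous in [(y, v)], as
   it is continuous in [y] on a basis. *)
Lemma C1_at_comp U V W (f : U -> V) (g : V -> W) x : finite_basis V ->
  C1_at f x -> C1_at g (f x) -> C1_at (g \o f) x.
Proof.
move=> [I [e [c [cc ce]]]] Cf [dg cg]; have [df cf] := Cf.
have ctf := C1_at_continuous Cf.
have dgf : \forall y \near x, differentiable g (f y) by exact: (ctf _ dg).
apply: (@C1_at_from _ _ _ (fun y v => 'd g (f y) ('d f y v))) => [|v].
  near=> y.
  have dfy : differentiable f y by near: y.
  have dgy : differentiable g (f y) by near: y.
  by split; [exact: differentiable_comp|rewrite diff_comp].
have -> : (fun y => 'd g (f y) ('d f y v)) =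
    fun y => \sum_i c i ('d f y v) *: 'd g (f y) (e i).
  apply/funext => y; rewrite [in LHS](ce ('d f y v)) linear_sum.
  by apply: eq_bigr => i _; rewrite linearZ.
apply: cvg_big => [|i _]; first exact: add_continuous.
have h1 : c i ('d f y v) @[y --> x] --> c i ('d f x v).
  exact: (continuous_comp (cf v) (cc i _)).
have h2 : 'd g (f y) (e i) @[y --> x] --> 'd g (f x) (e i).
  exact: (continuous_comp ctf (cg (e i))).
exact: cvgZ h1 h2.
Unshelve. all: by end_near. Qed.

Lemma C1_at_row n V (f : V -> 'rV[R]_n) x :
  (forall k, C1_at (fun y => f y ord0 k) x) -> C1_at f x.
Proof.
move=> fC; rewrite (_ : f = fun y => \sum_k f y ord0 k *: delta_mx ord0 k);
  last first.
  by apply/funext => y; exact: row_sum_delta.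
apply: C1_at_sum => k.
pose s (r : R) : 'rV[R]_n := r *: delta_mx ord0 k.
have Cs (r : R) : C1_at s r.
  apply: (@C1_at_from R _ s (fun=> s)) => [|v]; last exact: cvg_cst.
  near=> y.
  by split; [exact: (@ex_diff _ _ _ _ _ _ _ (is_diff_scalel _ _))|
             exact: (@diff_val _ _ _ _ _ _ _ (is_diff_scalel _ _))].
by apply: (@C1_at_comp _ _ _ (fun y => f y ord0 k) s) => //;
  exact: finite_basis_R.
Unshelve. all: by end_near.
Qed.

Lemma C1_at_coord n k (x : 'rV[R]_n) : C1_at (fun y : 'rV[R]_n => y ord0 k) x.
Proof.
apply: (@C1_at_from 'rV[R]_n R _ (fun _ (v : 'rV[R]_n) => v ord0 k)) => [|v].
  2: exact: (@cst_continuous _ _ (v ord0 k)).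
near=> y; split; first exact: differentiable_coord.
apply/funext => v; rewrite -deriveE; last exact: differentiable_coord.
exact: (@derive_val _ _ _ _ _ _ _ (is_derive_coord y v k)).
Unshelve. all: by end_near. Qed.

Lemma C1_at_inv V (f : V -> R) x : f x != 0 -> C1_at f x ->
  C1_at (fun y => (f y)^-1) x.
Proof.
move=> fx0 Cf; apply: (@C1_at_comp V R R f (@GRing.inv R)) => //.
  exact: finite_basis_R.
apply: (@C1_at_real _ (fun r => - r ^- 2)).
  have : \forall y \near f x, y != 0 by apply: open_nbhs_nbhs; split => //;
    exact: open_neq.
  apply: filterS => y y0; apply: DeriveDef; first exact: derivableV.
  by rewrite deriveV// derive_val /GRing.scale/= mulr1.
apply: cvgN; apply: cvgV; first by rewrite expf_neq0.
exact: exprn_continuous.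
Qed.

Lemma C1_at_sqrt V (f : V -> R) x : 0 < f x -> C1_at f x ->
  C1_at (fun y => Num.sqrt (f y)) x.
Proof.
move=> fx0 Cf; apply: (@C1_at_comp V R R f (@Num.sqrt R)) => //.
  exact: finite_basis_R.
apply: (@C1_at_real _ (fun r => (2 * Num.sqrt r)^-1)).
  by near=> y; apply: is_derive1_sqrt; near: y; exact: lt_nbhsr.
apply: cvgV; first by rewrite mulf_neq0// gt_eqF// sqrtr_gt0.
apply: cvgM; first exact: cvg_cst.
exact: sqrt_continuous.
Unshelve. all: by end_near. Qed.

End C1_at.

(** * Differentiation under the integral sign *)

Section strict_differentiability.
Context {R : realType}.

Lemma is_derive_line (V : normedModType R) (f : V -> R) (y h : V) (s : R) :
  differentiable f (y + s *: h) ->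
  is_derive s 1 (fun t : R => f (y + t *: h)) ('d f (y + s *: h) h).
Proof.
move=> df.
have dl : is_diff s (fun t : R => y + t *: h) (fun t => t *: h).
  have := is_diffD (is_diff_cst y s) (is_diff_scalel s h).
  by move=> [d1 d2]; apply: DiffDef => //; rewrite d2; apply/funext => t /=;
    exact: add0r.
have dld := @ex_diff _ _ _ _ _ _ _ dl; have dlv := @diff_val _ _ _ _ _ _ _ dl.
have dc : differentiable (f \o (fun t : R => y + t *: h)) s.
  exact: differentiable_comp.
apply: DeriveDef; first exact: diff_derivable.
by rewrite deriveE// diff_comp// /= dlv scale1r.
Qed.

(** Upgrades continuity of the differential at each vector to continuity in operator norm: closeness
    on the finitely many [b i] controls all vectors of norm at most r, and homogeneity does the
    rest. *)
Lemma diff_near_opnorm (V : normedModType R) (f : V -> R) (x : V) (e : R) :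
  finite_basis V -> C1_at f x -> 0 < e ->
  \forall y \near x, forall v, `|'d f y v - 'd f x v| <= e * `|v|.
Proof.
move=> [I [b [c [cc ce]]]] [df cf] e0.
(* The coefficients are only known to be continuous, hence bounded near 0 by their value there plus
   one. *)
have [r r0 cb] : exists2 r : R, 0 < r & forall v : V, `|v| <=
  r -> forall i, `|c i v| <= `|c i 0| + 1.
  have : \forall v \near (0 : V), forall i, `|c i v| <= `|c i 0| + 1.
    apply: filter_forall => i.
    have := cc i 0 => /cvgrPdist_le /(_ 1 ltr01); apply: filterS => v.
    by rewrite distrC -lerBlDl; apply: le_trans; exact: lerB_dist.
  move=> /nbhs_ballP[r /= r0 rb]; exists (r / 2); first exact: divr_gt0.
  move=> v vr; apply: rb; rewrite -ball_normE /ball_/= sub0r normrN.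
  by rewrite (le_lt_trans vr)// ltr_pdivrMr// ltr_pMr// ltr1n.
pose M := 1 + \sum_i (`|c i 0| + 1).
have M0 : 0 < M by rewrite ltr_pwDl// sumr_ge0// => i _; rewrite addr_ge0.
have dE y v : 'd f y v = \sum_i c i v * 'd f y (b i).
  by rewrite [in LHS](ce v) linear_sum; apply: eq_bigr => i _; rewrite linearZ.
have : \forall y \near x, forall i, `|'d f x (b i) - 'd f y (b i)| <= e * r / M.
  apply: filter_forall => i; have /cvgrPdist_le := cf (b i); apply.
  by rewrite divr_gt0// mulr_gt0.
apply: filterS => y yx v.
have small w : `|w| <= r -> `|'d f y w - 'd f x w| <= e * r.
  move=> wr; rewrite !dE -sumrB.
  apply: (@le_trans _ _ (\sum_i (`|c i 0| + 1) * (e * r / M))).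
    apply: (le_trans (ler_norm_sum _ _ _)); apply: ler_sum => i _.
    by rewrite -mulrBr normrM ler_pM ?cb// distrC.
  rewrite -mulr_suml mulrCA ler_piMr ?mulr_ge0 ?ltW// ltr_pdivrMr// mul1r.
  by rewrite /M ltrDr.
have [->|v0] := eqVneq v 0;
  first by rewrite [X in X - _]linear0 [X in _ - X]linear0 subr0 !normr0 mulr0.
have nv : 0 < `|v| by rewrite normr_gt0.
have rv0 : 0 < r / `|v| by exact: divr_gt0.
have nE : `|(r / `|v|) *: v| = r.
  by rewrite normrZ (gtr0_norm rv0) divfK// gt_eqF.
(* Rescaling v to norm r carries the estimate to all of V. *)
have := small ((r / `|v|) *: v); rewrite nE => /(_ (lexx _)).
rewrite [X in X - _]linearZ [X in _ - X]linearZ -scalerBr normrZ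
  (gtr0_norm rv0) => h.
rewrite -ler_pdivlMl// in h.
by rewrite (le_trans h)// le_eqVlt; apply/orP; left; apply/eqP; field;
  rewrite !gt_eqF.
Qed.

(** Strict differentiability: the base point y varies while the differential stays the one at x. The
    mean value theorem on [y, y + h] replaces the increment by a differential at a point near x, to
    which [diff_near_opnorm] applies. *)
Lemma C1_strict (V : normedModType R) (f : V -> R) (x : V) (e : R) :
  finite_basis V -> C1_at f x -> 0 < e ->
  \forall y \near x & h \near (0 : V),
    `|f (y + h) - f y - 'd f x h| <= e * `|h|.
Proof.
move=> fb Cf e0; have [df _] := Cf.
have : \forall y \near x, differentiable f y /\ forall v, `|'d f y v - 'd f x v|
  <= e * `|v|.
  apply: filterS2 df (diff_near_opnorm fb Cf e0) => y dy oy; split => //.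
move=> /nbhs_ballP[d /= d0 hd].
(* Half radii keep the whole segment from y to y + h inside the ball of radius d. *)
exists (ball x (d / 2), ball 0 (d / 2)) => /=.
  by split; exact: nbhsx_ballx (divr_gt0 d0 _).
move=> [y h] /= [xy h0].
have seg (s : R) : 0 <= s <= 1 -> ball x d (y + s *: h).
  move=> /andP[s0 s1]; rewrite (splitr d).
  apply: (ball_triangle xy); move: h0.
  rewrite -!ball_normE /ball_/= sub0r normrN opprD addNKr normrN normrZ.
  by apply: le_lt_trans; rewrite ger0_norm// ler_piMl.
have dl (s : R) : 0 <= s <= 1 ->
    is_derive s 1 (fun t : R => f (y + t *: h)) ('d f (y + s *: h) h).
  by move=> /seg/hd[ds _]; exact: is_derive_line.
have cl : {within `[0, 1], continuous (fun t : R => f (y + t *: h))}.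
  apply: derivable_within_continuous => s; rewrite in_itv/= => /dl ds.
  exact: (@ex_derive _ _ _ _ _ _ _ ds).
have [|c c01] := MVT ltr01 _ cl (df := fun s => 'd f (y + s *: h) h).
  by move=> s; rewrite in_itv/= => /andP[s0 s1]; apply: dl; rewrite !ltW.
rewrite scale1r scale0r addr0 subr0 mulr1 => ->.
have [|_] := hd (y + c *: h); last exact.
by apply: seg; move: c01; rewrite in_itv/= => /andP[s0 s1]; rewrite !ltW.
Qed.

End strict_differentiability.

(** * Estimates uniform over a compact set of parameters *)

Section compact_parameter.
Context {R : realType} {V W : normedModType R}.
Variables (K : V * W -> R) (S : set W) (x : V).
Hypotheses (fV : finite_basis V) (fW : finite_basis W) (cS : compact S).
Hypothesis KC : forall u, S u -> C1_at K (x, u).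

Lemma normr_pair0 (h : V) : `|(h, 0 : W)| = `|h|.
Proof. by rewrite prod_normE/= normr0 max_l. Qed.

(** Around each u of S, strict differentiability bounds the increment at (x, u') against the
    differential at (x, u), for all u' near u. Exchanging that differential for the one at (x, u')
    costs the other half of e. The neighbourhood of h is then made common to all of S by
    compactness, in its near-covering form. *)
Lemma uniform_partial_diff e : 0 < e -> \forall h \near
  (0 : V), forall u, S u ->
  `|K (x + h, u) - K (x, u) - 'd K (x, u) (h, 0)| <= e * `|h|.
Proof.
move=> e0.
pose P (h : V) (u : W) := `|K (x + h, u) - K (x, u) - 'd K (x, u) (h, 0)| <=
  e * `|h|.
apply: ((near_covering_withinP S).2 ((compact_near_coveringP S).1 cS) _ _ P).
move=> u Su; have CK := KC Su.
have e20 : 0 < e / 2 by exact: divr_gt0.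
have near_xu (Q : V * W -> Prop) :
    (\forall q \near (x, u), Q q) -> \forall u' \near u, Q (x, u').
  move=> nQ; have c : (x, u') @[u' --> u] --> (x, u) by apply: cvg_pair;
    [exact: cvg_cst|exact: cvg_id].
  exact: c.
have := C1_strict (finite_basis_pair fV fW) CK e20.
move=> [[A B] /= [nA nB] AB].
have h1 : \forall u' \near u, A (x, u') by exact: near_xu.
have h2 := near_xu _ (diff_near_opnorm (finite_basis_pair fV fW) CK e20).
have h3 : \forall h \near (0 : V), B (h, 0).
  have c : (h, 0 : W) @[h --> (0 : V)] --> ((0 : V), (0 : W)).
    by apply: cvg_pair; [exact: cvg_id|exact: cvg_cst].
  exact: (c _ nB).
near=> u' h => _; rewrite /P.
have Au' : A (x, u') by near: u'.
have du' : forall v, `|'d K (x, u') v - 'd K (x, u) v| <= e / 2 * `|v|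
  by near: u'.
have Bh : B (h, 0) by near: h.
have s1 : `|K (x + h, u') - K (x, u') - 'd K (x, u) (h, 0)| <= e / 2 * `|h|.
  have := AB ((x, u'), (h, 0)) (conj Au' Bh).
  by rewrite /= -[(x, u') + (h, 0)]/(x + h, u' + 0) addr0 normr_pair0.
have s2 : `|'d K (x, u) (h, 0) - 'd K (x, u') (h, 0)| <= e / 2 * `|h|.
  by rewrite distrC -(normr_pair0 h); exact: du'.
apply: le_trans (ler_distD ('d K (x, u) (h, 0)) _ _) _.
have -> : e * `|h| = e / 2 * `|h| + e / 2 * `|h| by rewrite -mulrDl -splitr.
exact: lerD s1 s2.
Unshelve. all: by end_near. Qed.

(** Near (x, u) both differentials are within e/2 of the one at (x, u); compactness of S makes the
    neighbourhood of x common. *)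
Lemma uniform_partial_continuous v e : 0 < e -> \forall y \near x, forall u, S u
  ->
  `|'d K (y, u) (v, 0) - 'd K (x, u) (v, 0)| <= e.
Proof.
move=> e0.
pose P (y : V) (u : W) := `|'d K (y, u) (v, 0) - 'd K (x, u) (v, 0)| <= e.
apply: ((near_covering_withinP S).2 ((compact_near_coveringP S).1 cS) _ _ P).
have e20 : 0 < e / 2 by exact: divr_gt0.
move=> u Su; have [_ /(_ (v, 0))/cvgrPdist_le] := KC Su.
move=> /(_ (e / 2) e20)[[A B] /= [nA nB] AB].
near=> u' y => _; rewrite /P.
have Bu : B u' by near: u'.
have Ay : A y by near: y.
have Ax : A x by exact: nbhs_singleton.
have s1 := AB (y, u') (conj Ay Bu); have s2 := AB (x, u') (conj Ax Bu).
rewrite /= in s1 s2; rewrite distrC in s1.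
apply: le_trans (ler_distD ('d K (x, u) (v, 0)) _ _) _.
by rewrite [leRHS]splitr; exact: lerD s1 s2.
Unshelve. all: by end_near. Qed.

Lemma partial_bounded v : exists C, forall u, S u -> `|'d K (x, u) (v, 0)| <= C.
Proof.
pose P (C : R) (u : W) := `|'d K (x, u) (v, 0)| <= C.
(* The bound itself is the parameter of the covering argument: near each point of S, every large C
   works. *)
suff : \forall C \near +oo, S `<=` P C by move=> [C [_ h]]; exists (C + 1);
  apply: h; rewrite ltrDl.
apply: ((near_covering_withinP S).2 ((compact_near_coveringP S).1 cS) _ _ P).
move=> u Su; have [_ /(_ (v, 0))/cvgrPdist_le] := KC Su.
move=> /(_ 1 ltr01)[[A B] /= [nA nB] AB].
near=> u' C => _; rewrite /P.
have Bu : B u' by near: u'.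
have s := AB (x, u') (conj (nbhs_singleton nA) Bu).
rewrite /= distrC in s;
  rewrite (le_trans _ (_ : `|'d K (x, u) (v, 0)| + 1 <= C))//.
by rewrite -lerBlDl (le_trans (lerB_dist _ _)).
Unshelve. all: by end_near. Qed.

End compact_parameter.

Section derivation_under_integral.
Local Open Scope ereal_scope.
Context {R : realType} {V : normedModType R} d (T : measurableType d).
Variables (mu : {measure set T -> \bar R}) (D : set T) (m : T -> R).
Variables (U : set V) (K : V -> T -> R) (L : V -> T -> {linear V -> R}).
Hypotheses (mD : measurable D) (im : mu.-integrable D (EFin \o m)).
Hypotheses (fV : finite_basis V) (oU : open U).
Hypothesis mK : forall x, U x -> measurable_fun D (K x).
Hypothesis mL : forall x v, U x -> measurable_fun D (fun z => L x z v).
Hypothesis bK : forall x, U x -> exists C : R, forall z, D z -> (`|K x z| <=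
  C)%R.
Hypothesis bL : forall x v, U x -> exists C : R, forall z, D z -> (`|L x z v| <=
  C)%R.
Hypothesis dK : forall x (e : R), U x -> (0 < e)%R -> \forall h \near (0%R : V),
  forall z, D z -> (`|K (x + h) z - K x z - L x z h| <= e * `|h|)%R.
Hypothesis cL : forall x v (e : R), U x -> (0 < e)%R -> \forall y \near x,
  forall z, D z -> (`|L y z v - L x z v| <= e)%R.

Let mm : measurable_fun D m.
Proof. exact/measurable_EFinP/(measurable_int mu). Qed.

Lemma integrable_bounded_mul (f : T -> R) : measurable_fun D f ->
  (exists C : R, forall z, D z -> (`|f z| <= C)%R) ->
  mu.-integrable D (EFin \o (fun z => f z * m z)%R).
Proof.
move=> mf [C fC]; apply: (@le_integrable _ _ _ mu D mD _ (fun z =>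
  (C * m z)%:E)).
- by apply/measurable_EFinP; exact: measurable_funM.
- move=> z Dz; rewrite lee_fin !normrM ler_wpM2r// (le_trans (fC z Dz))//.
  exact: ler_norm.
- exact: (integrableZl mD C im).
Qed.

Let iL x v : U x -> mu.-integrable D (EFin \o (fun z => L x z v * m z)%R).
Proof. by move=> Ux; apply: integrable_bounded_mul; [exact: mL|exact: bL]. Qed.

Let iK x : U x -> mu.-integrable D (EFin \o (fun z => K x z * m z)%R).
Proof. by move=> Ux; apply: integrable_bounded_mul; [exact: mK|exact: bK]. Qed.

Let M := (\int[mu]_(z in D) `|m z|)%R.

Let inm : mu.-integrable D (EFin \o (fun z => `|m z|)%R).
Proof.
apply: (@le_integrable _ _ _ mu D mD _ (EFin \o m)) => //.
  by apply/measurable_EFinP; exact: measurableT_comp.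
by move=> z Dz; rewrite /= normr_id.
Qed.

Lemma Rintegral_bounded_mul (f : T -> R) (e : R) : measurable_fun D f ->
  (forall z, D z -> (`|f z| <= e)%R) ->
  (`|\int[mu]_(z in D) (f z * m z)| <= e * M)%R.
Proof.
move=> mf fe; have if_ : mu.-integrable D (EFin \o (fun z => f z * m z)%R).
  by apply: integrable_bounded_mul => //; exists e.
apply: (le_trans (le_normr_Rintegral mD if_)).
rewrite /M -RintegralZl//; apply: le_Rintegral => //.
- apply: (@le_integrable _ _ _ mu D mD _ (EFin \o
  (fun z => f z * m z)%R)) => //.
    apply/measurable_EFinP; apply: measurableT_comp => //.
    exact: measurable_funM.
  by move=> z Dz; rewrite /= normr_id.
- exact: (integrableZl mD e inm).
- by move=> z Dz; rewrite normrM ler_wpM2r// fe.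
Qed.

Local Close Scope ereal_scope.
Let I x v : R := \int[mu]_(z in D) (L x z v * m z).

Let I_linear x : U x -> linear (I x).
Proof.
move=> Ux a v w; transitivity (a * I x v + I x w); last by [].
rewrite /I -RintegralZl//; last exact: iL.
rewrite -RintegralD//; last first.
- exact: iL.
- by have := integrableZl mD a (iL v Ux).
- apply: eq_Rintegral => z _; rewrite linearP /=.
  by rewrite -[X in (X + _) * _]/(a * L x z v) mulrDl mulrA.
Qed.

(** The weight m does not depend on the parameter, and the remainder of K is at most e |h| uniformly
    in z. Integration against m multiplies this by M, the integral of |m|, so [I] is the
    differential. *)
Lemma C1_at_Rintegral x : U x -> C1_at (fun y => \int[mu]_(z in D)
  (K y z * m z)) x.
Proof.
move=> Ux; have M0 : 0 <= M by apply: Rintegral_ge0.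
(* Tolerances are divided by M + 1, as M may be zero. *)
have M1 : 0 < M + 1 by rewrite ltr_wpDl.
have nU : \forall y \near x, U y by apply: open_nbhs_nbhs.
apply: (@C1_at_from _ _ _ _ I) => [|v].
  apply: filterS nU => y Uy.
  pose lI := GRing.isLinear.Build _ _ _ _ _ (I_linear Uy).
  pose LI : {linear V -> R} := HB.pack (I y) lI.
  apply: (@eps_diff _ _ _ _ y LI).
    have [J [b [c [cc ce]]]] := fV.
    rewrite (_ : LI = (fun v => \sum_i c i v * LI (b i)) :> (V -> R));
      last first.
      by apply/funext => v; rewrite [in LHS](ce v) linear_sum;
        apply: eq_bigr => i _; rewrite linearZ.
    move=> v; apply: cvg_big => [|i _]; first exact: add_continuous.
    by apply: cvgM; [exact: cc|exact: cvg_cst].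
  move=> e e0; have nyU : \forall h \near (0 : V), U (y + h).
    have nUy : \forall z \near y, U z by apply: open_nbhs_nbhs.
    by move: nUy; rewrite (near_shift 0); apply: filterS => h /=;
      rewrite subr0 addrC.
  apply: filterS2 nyU (dK Uy (divr_gt0 e0 M1)) => h Uh hh.
  have i1 := iK Uh; have i2 := iK Uy; have i3 := iL h Uy.
  have i12 : mu.-integrable D (EFin \o (fun z => K
    (y + h) z * m z - K y z * m z)).
    exact: (integrableB mD i1 i2).
  rewrite (addrC h) -[LI h]/(\int[mu]_(z in D) (L y z h * m z)).
  rewrite -(RintegralB mD i1 i2) -(RintegralB mD i12 i3).
  under eq_Rintegral do rewrite -!mulrBl.
  apply: (le_trans (Rintegral_bounded_mul _ hh)).
    by apply: measurable_funB; [apply: measurable_funB; exact: mK|exact: mL].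
  by rewrite mulrAC ler_wpM2r// mulrAC ler_pdivrMr// ler_wpM2l ?ltW// ltrDl.
suff : I y v @[y --> x] --> I x v by [].
apply/cvgrPdist_le => e e0.
apply: filterS2 nU (cL v Ux (divr_gt0 e0 M1)) => y Uy hy.
rewrite /I -(RintegralB mD (iL v Ux) (iL v Uy)).
under eq_Rintegral do rewrite -!mulrBl.
have hy' z : D z -> `|L x z v - L y z v| <= e / (M + 1) by rewrite distrC;
  exact: hy.
apply: (le_trans (Rintegral_bounded_mul _ hy')).
  by apply: measurable_funB; exact: mL.
by rewrite mulrAC ler_pdivrMr// ler_wpM2l ?ltW// ltrDl.
Qed.

End derivation_under_integral.

(** * Borel sets, scaling and radial integrals on R^n *)

Section rV_borel.
Context {R : realType} {n : nat}.

(** Balls of row vectors are those of the supremum norm, hence boxes. *)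
Lemma measurable_ball_rV (x : 'rV[R]_n) (e : R) : 0 < e -> measurable
  (ball x e).
Proof.
move=> e0; rewrite (_ : ball x e = \bigcap_(i in [set: 'I_n])
    ((fun v : 'rV[R]_n => v ord0 i) @^-1` ball (x ord0 i) e)); last first.
  apply/seteqP; split => [y [_ xy] i _|y xy]; first exact: xy.
  by split => // i j; rewrite ord1; exact: xy.
apply: fin_bigcap_measurable; first exact: finite_finset.
move=> i _; rewrite -[X in measurable X]setTI.
by apply: measurable_rV_coord => //; exact: measurable_ball.
Qed.

(** An open set is the union of the balls with rational centre and radius 1/(k+1) that it contains.
    The union runs over all such pairs, with the empty set for the balls not contained in A, so the
    index set is plainly countable. *)
Lemma measurable_open_rV (A : set 'rV[R]_n) : open A -> measurable A.
Proof.
move=> oA.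
pose B (p : 'rV[rat]_n * nat) : set 'rV[R]_n := ball
  (map_mx ratr p.1 : 'rV[R]_n) p.2.+1%:R^-1.
rewrite (_ : A = \bigcup_p (if `[< B p `<=` A >] then B p else set0));
  last first.
  apply/seteqP; split => [x Ax|x [p _]]; last by case: asboolP => // pA /pA.
  have /nbhs_ballP[e /= e0 xeA] : nbhs x A by apply: open_nbhs_nbhs.
  have [k ke] : exists k : nat, k.+1%:R^-1 < e / 2 :> R.
    have e20 : 0 < e / 2 by exact: divr_gt0.
    exists (Num.truncn (e / 2)^-1); rewrite invf_plt ?posrE//.
    exact: truncnS_gt.
  have /choice[q qP] : forall i, exists q : rat, `|x ord0 i - ratr q| <
    k.+1%:R^-1.
    move=> i.
    have /rat_in_itvoo[q /itvP qx] : x ord0 i - k.+1%:R^-1 < x ord0 i.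
      by rewrite gtrBl invr_gt0.
    exists q; rewrite ltr_norml; apply/andP; split.
      by rewrite (lt_trans (_ : _ < 0)) ?subr_gt0 ?qx// oppr_lt0 invr_gt0.
    by rewrite ltrBlDr -ltrBlDl qx.
  exists (\row_i q i, k) => //=; case: asboolP => [_|[]]; last first.
    move=> y qy; apply: xeA; rewrite (splitr e).
    apply: (ball_triangle (y := map_mx ratr (\row_i q i) : 'rV[R]_n)).
      split; first exact: divr_gt0.
      move=> i j; rewrite ord1 !mxE /ball/=; apply: lt_trans ke.
      exact: qP.
    by apply: le_ball qy; exact: ltW.
  split; first by rewrite invr_gt0.
  by move=> i j; rewrite ord1 !mxE /ball/= distrC; exact: qP.
apply: countable_bigcupT_measurable => // p; case: ifP => // _.
by apply: measurable_ball_rV; rewrite invr_gt0.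
Qed.

Lemma continuous_on_measurable_fun (D : set 'rV[R]_n)
  (f : 'rV[R]_n -> R) : open D ->
  (forall x, D x -> {for x, continuous f}) -> measurable_fun D f.
Proof.
move=> oD cf mD; apply: (measurability _ (RGenOInfty.measurableE R)) => //.
move=> _ [_ [a ->] <-]; apply: measurable_open_rV.
rewrite openE => x [Dx /=]; rewrite in_itv/= andbT => afx.
apply: filterI; first exact: open_nbhs_nbhs.
have : \forall y \near x, a < f y.
  by have := cf x Dx => /cvgr_gt; apply.
by apply: filterS => y; rewrite /= in_itv/= andbT.
Qed.

End rV_borel.

Section scaling.
Context {R : realType}.
Local Open Scope ereal_scope.

Lemma measurable_scale_rV n (s : R) :
  measurable_fun [set: 'rV[R]_n] (fun v : 'rV[R]_n => (s *: v)%R).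
Proof.
apply/measurable_fun_rVP => i; under eq_fun do rewrite mxE.
by apply: measurable_funM => //; exact: measurable_rV_coord.
Qed.

Lemma measurable_mulR (s : R) :
  measurable_fun [set: measurableTypeR R] (fun x : measurableTypeR R =>
    (s * x)%R : measurableTypeR R).
Proof. by apply: measurable_funM. Qed.

Lemma lebesgue_measure_scale (s : R) (s0 : (0 < s)%R) (A : set
  (measurableTypeR R)) :
  measurable A ->
  s%:E * pushforward lebesgue_measure (fun x : measurableTypeR R =>
    (s * x)%R : measurableTypeR R) A =
  lebesgue_measure A.
Proof.
move=> mA; apply/esym.
pose f := fun x : measurableTypeR R => (s * x)%R : measurableTypeR R.
pose s' : {nonneg R} := NngNum (ltW s0).
pose mf : {measure set (measurableTypeR R) -> \bar R} := mscale s'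
  (pushforward lebesgue_measure f).
pose m := mf (measurable_mulR s).
suff h X : ocitv X -> lebesgue_measure X = m X by exact:
  (lebesgue_measure_unique h mA).
move=> [[a b] _ <-] /=.
rewrite /m /mscale /= /pushforward.
rewrite (_ : _ @^-1` _ = `](a / s)%R, (b / s)%R]%classic); last first.
  apply/seteqP; split => x /=; rewrite !in_itv/= => /andP[ax xb].
    by rewrite ltr_pdivrMr// ler_pdivlMr// mulrC ax.
  by move: ax xb; rewrite ltr_pdivrMr// ler_pdivlMr// mulrC => -> ->.
rewrite !lebesgue_measure_itv/= !lte_fin ltr_pM2r ?invr_gt0//.
case: ifP => _; rewrite ?mule0// !EFinN -!EFinB -EFinM; congr EFin.
by field; rewrite gt_eqF.
Qed.

Lemma ge0_integral_scale1 (s : R) (s0 : (0 < s)%R) (f : R -> \bar R) :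
  measurable_fun [set: measurableTypeR R] (f : measurableTypeR R -> \bar R) ->
  (forall x, 0 <= f x) ->
  s%:E * \int[lebesgue_measure]_x f (s * x)%R = \int[lebesgue_measure]_x f x.
Proof.
move=> mf f0.
pose h := fun x : measurableTypeR R => (s * x)%R : measurableTypeR R.
pose s' : {nonneg R} := NngNum (ltW s0).
pose mf' : {measure set (measurableTypeR R) -> \bar R} :=
  pushforward lebesgue_measure h.
pose m := mf' (measurable_mulR s).
have := ge0_integral_pushforward
  (measurable_mulR s) lebesgue_measure measurableT mf (fun x _ => f0 x).
rewrite preimage_setT => <-.
rewrite -(@ge0_integral_mscale _ _ _ m _ measurableT s')//.
apply: eq_measure_integral => A mA _.
exact: (lebesgue_measure_scale s0 mA).
Qed.

(** By induction through sections: the first coordinate contributes one factor s, by the scaling of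
    one-dimensional integrals, and each section contributes s^n. *)
Lemma lebesgue_rV_scale n (s : R) (s0 : (0 < s)%R) (A : set 'rV[R]_n) :
  measurable A ->
  (s ^+ n)%:E * lebesgue_rV n ((fun v => s *: v)%R @^-1` A) = lebesgue_rV n A.
Proof.
elim: n A => [|n IH] A mA.
  rewrite expr0 mul1e; congr (lebesgue_rV 0 _); apply/seteqP.
  by split => v /=; rewrite (_ : (s *: v)%R = v)//; apply/rowP => -[].
have mC B : measurable B -> measurable (@consv R n @^-1` B).
  by move=> mB; rewrite -[X in measurable X]setTI; exact: measurable_consv.
have stepE B : lebesgue_rV n.+1 B =
    \int[lebesgue_measure]_x lebesgue_rV n (xsection (@consv R n @^-1` B) x).
  by [].
rewrite !stepE.
have mF := measurable_fun_xsection (lebesgue_rV n) (mC _ mA).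
have secE x : xsection (@consv R n @^-1` ((fun v => s *: v)%R @^-1` A)) x =
    (fun v => s *: v)%R @^-1` xsection (@consv R n @^-1` A) (s * x)%R.
  rewrite !xsectionE; apply/seteqP.
  have cE v : (s *: consv (x, v))%R = consv (s * x, s *: v)%R :> 'rV[R]_n.+1.
    by apply/rowP => i; rewrite mxE !consvE; case: unlift => //= j; rewrite mxE.
  by split => v /=; rewrite cE.
rewrite exprS EFinM -muleA -ge0_integralZl//; last 2 first.
- apply: measurable_fun_xsection; apply: mC; rewrite -[X in measurable X]setTI.
  exact: measurable_scale_rV.
- by rewrite lee_fin exprn_ge0// ltW.
rewrite -(ge0_integral_scale1 s0 mF) //; congr (_ * _);
  apply: eq_integral => x _.
by rewrite secE IH//; exact: measurable_xsection (mC _ mA).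
Qed.

End scaling.

Section density.
Local Open Scope ereal_scope.
Context d (T : measurableType d) (R : realType).
Variables (mu : {measure set T -> \bar R}) (w : T -> R).
Hypotheses (mw : measurable_fun setT w) (w0 : forall x, (0 <= w x)%R).

(** The proofs of measurability and sign are arguments so that the measure structure can be attached
    to the term itself. *)
Definition density of measurable_fun setT w & (forall x, (0 <= w x)%R) :=
  fun A : set T => \int[mu]_(x in A) (w x)%:E.

Local Notation dens := (density mw w0).

Let density0 : dens set0 = 0. Proof. by rewrite /density integral_set0. Qed.

Let density_ge0 A : 0 <= dens A.
Proof. by apply: integral_ge0 => x _; rewrite lee_fin. Qed.

Let density_sigma_additive : semi_sigma_additive dens.
Proof.
move=> F mF tF mUF; rewrite /density ge0_integral_bigcup//; last 2 first.
- by apply/measurable_EFinP; exact: measurable_funTS.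
- by move=> x _; rewrite lee_fin.
apply: is_cvg_ereal_nneg_natsum => n _.
by apply: integral_ge0 => x _; rewrite lee_fin.
Qed.

HB.instance Definition _ := isMeasure.Build _ _ _ dens
  density0 density_ge0 density_sigma_additive.

Import HBNNSimple.

Let integral_density_indic E : measurable E ->
  \int[dens]_x (\1_E x)%:E = \int[mu]_x ((\1_E x)%:E * (w x)%:E).
Proof.
move=> mE; rewrite integral_indic// setIT /= /density integral_mkcond.
apply: eq_integral => x _; rewrite /patch /indic.
by case: ifP => xE; rewrite ?mul1e ?mul0e.
Qed.

Let integral_density_nnsfun (f : {nnsfun T >-> R}) :
  \int[dens]_x (f x)%:E = \int[mu]_x ((f x)%:E * (w x)%:E).
Proof.
under [LHS]eq_integral do rewrite fimfunE -fsumEFin//.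
rewrite [LHS]ge0_integral_fsum//; last 2 first.
  - by move=> r; exact/measurable_EFinP/measurableT_comp.
  - by move=> n x _; rewrite EFinM nnfun_muleindic_ge0.
under [RHS]eq_integral.
  move=> x _; rewrite fimfunE -fsumEFin// ge0_mule_fsuml; last first.
    by move=> r; rewrite EFinM nnfun_muleindic_ge0.
  over.
rewrite [RHS]ge0_integral_fsum//; last 2 first.
  - move=> r; apply: emeasurable_funM; last exact/measurable_EFinP.
    by apply/measurable_EFinP; exact/measurableT_comp.
  - by move=> n x _; rewrite EFinM mule_ge0// ?nnfun_muleindic_ge0// lee_fin.
apply: eq_fsbigr => r _.
under [RHS]eq_integral do rewrite EFinM -muleA.
(* A negative r is not a value of f, so both integrands vanish. *)
have [r0|r0] := leP 0%R r; last first.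
  by rewrite !integral0_eq// => x _;
    rewrite preimage_nnfun0// indic0 ?mulr0 ?mul0e ?mule0.
rewrite [RHS]ge0_integralZl//; last 2 first.
- apply: emeasurable_funM; last exact/measurable_EFinP.
  by apply/measurable_EFinP.
- by move=> x _; rewrite mule_ge0 ?lee_fin.
rewrite -integral_density_indic//.
by under eq_integral do rewrite EFinM; rewrite ge0_integralZl//;
  exact/measurable_EFinP.
Qed.

Lemma ge0_integral_density (f : T -> \bar R) :
  measurable_fun setT f -> (forall x, 0 <= f x) ->
  \int[dens]_x f x = \int[mu]_x (f x * (w x)%:E).
Proof.
move=> mf f0; pose f_ := nnsfun_approx measurableT mf.
transitivity (lim (\int[dens]_x (f_ n x)%:E @[n --> \oo])).
  rewrite -monotone_convergence//=.
  - apply: eq_integral => ? /[!inE] xD; apply/esym/cvg_lim => //=.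
    exact: cvg_nnsfun_approx.
  - by move=> n; exact/measurable_EFinP/measurable_funTS.
  - by move=> n ? _; rewrite lee_fin.
  - by move=> ? _ ? ? mn; rewrite lee_fin; exact/lefP/nd_nnsfun_approx.
under eq_fun do rewrite integral_density_nnsfun.
rewrite -monotone_convergence//=.
- apply: eq_integral => x _; apply/cvg_lim => //.
  by apply: cvgeZr => //; exact: cvg_nnsfun_approx.
- move=> n; apply: emeasurable_funM; last exact/measurable_EFinP.
  by apply/measurable_EFinP.
- by move=> n x _; rewrite mule_ge0 ?lee_fin.
- move=> x _ m n mn; apply: lee_pmul; rewrite ?lee_fin//.
  exact/lefP/nd_nnsfun_approx.
Qed.

End density.

Section polar.
Context {R : realType}.
Local Open Scope ereal_scope.

Lemma continuous_enorm n : continuous (@enorm R n).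
Proof.
have c : continuous (fun x : 'rV[R]_n => \sum_i x ord0 i ^+ 2)%R.
  apply: continuous_big => [|i _ x]; first exact: add_continuous.
  by apply: (@continuous_comp _ _ _ (fun x : 'rV[R]_n => x ord0 i)
    (fun r : R => r ^+ 2)%R);
    [exact: coord_continuous|exact: exprn_continuous].
by move=> x; exact: (continuous_comp (c x) (@sqrt_continuous R _)).
Qed.

Lemma measurable_enorm n : measurable_fun [set: 'rV[R]_n] (@enorm R n).
Proof.
apply: continuous_on_measurable_fun => [|x _]; first exact: openT.
exact: continuous_enorm.
Qed.

(** Punctured at 0 in order to be the preimage of ]0, r] under the norm and, for r = 1, exactly the
    [cone] over the unit sphere. *)
Definition pball n (r : R) : set 'rV[R]_n := [set v | 0 < enorm v <= r]%R.
Arguments pball : clear implicits.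

Lemma measurable_enorm_preimage n (A : set R) : measurable A ->
  measurable (@enorm R n @^-1` A).
Proof. by move=> mA; rewrite -[X in measurable X]setTI;
  exact: measurable_enorm. Qed.

Lemma pballE n (r : R) : pball n r = @enorm R n @^-1` `]0%R, r].
Proof. by apply/seteqP; split => v /=; rewrite in_itv. Qed.

Lemma measurable_pball n (r : R) : measurable (pball n r).
Proof. by rewrite pballE; exact: measurable_enorm_preimage. Qed.

Lemma normr_coord_le n (v : 'rV[R]_n) i : (`|v ord0 i| <= enorm v)%R.
Proof.
rewrite -sqrtr_sqr /enorm ler_wsqrtr// (bigD1 i)//= lerDl sumr_ge0// => j _.
exact: sqr_ge0.
Qed.

Lemma pball1_fin n : lebesgue_rV n (pball n 1) < +oo.
Proof.
pose A (i : 'I_n) : set R := `[(-1)%R, 1%R]%classic.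
have mA i : measurable (A i) by exact: measurable_itv.
apply: (@le_lt_trans _ _ (lebesgue_rV n [set v | forall i, A i (v ord0 i)])).
  apply: le_measure; rewrite ?inE.
  - exact: measurable_pball.
  - rewrite [X in measurable X](_ : _ = \bigcap_(i in [set: 'I_n])
      ((fun v : 'rV[R]_n => v ord0 i) @^-1` A i)); last first.
      by apply/seteqP; split => v /= Av i; [move=> _|]; exact: Av.
    apply: fin_bigcap_measurable; first exact: finite_finset.
    move=> i _; rewrite -[X in measurable X]setTI.
    exact: measurable_rV_coord.
  - move=> v /andP[_ v1] i /=; rewrite /A /= in_itv/= -ler_norml.
    exact: le_trans (normr_coord_le v i) v1.
rewrite (lebesgue_rV_box mA) (eq_bigr (fun=> 2%:E)).
  have fin : \prod_(i < n) 2%:E \is a @fin_num R.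
    by elim/big_ind : _ => // x y; exact: fin_numM.
  by rewrite ltey; move: fin; case: (\prod_(i < n) _).
by move=> i _; rewrite lebesgue_measure_itv/= lte_fin ifT ?gtrN// -EFinB opprK.
Qed.

Definition pball1_vol n : R := fine (lebesgue_rV n (pball n 1)).

Lemma pball1_volE n : lebesgue_rV n (pball n 1) = (pball1_vol n)%:E.
Proof. by rewrite fineK// ge0_fin_numE// pball1_fin. Qed.

Lemma pball1_vol_ge0 n : (0 <= pball1_vol n)%R.
Proof. exact: fine_ge0. Qed.

Lemma pball_vol n r : (0 < r)%R ->
  lebesgue_rV n (pball n r) = (pball1_vol n * r ^+ n)%:E.
Proof.
move=> r0; rewrite -(lebesgue_rV_scale r0 (@measurable_pball n r)).
rewrite (_ : _ @^-1` _ = pball n 1); last first.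
  apply/seteqP; split => v /=; rewrite /pball/= enormZ gtr0_norm//.
    by rewrite pmulr_rgt0// ger_pMr.
  by rewrite pmulr_rgt0// ger_pMr.
by rewrite pball1_volE mulrC EFinM.
Qed.

(** The indicator of 0 < a reflects that nothing is removed when a = 0; it matters for n = 0, where
    a ^+ n is 1. *)
Lemma annulus_vol n a b : (0 <= a < b)%R ->
  lebesgue_rV n (@enorm R n @^-1` `]a, b]) =
  (pball1_vol n * b ^+ n - pball1_vol n * a ^+ n * (0 < a)%R%:R)%:E.
Proof.
move=> /andP[a0 ab]; have b0 : (0 < b)%R by exact: le_lt_trans ab.
move: a0; rewrite le_eqVlt => /predU1P[<-|a0].
  by rewrite -pballE pball_vol// ltxx mulr0 subr0.
have bfin : lebesgue_rV n (pball n b) < +oo by rewrite pball_vol// ltry.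
rewrite a0 mulr1 EFinB -!pball_vol//.
rewrite (_ : _ @^-1` _ = pball n b `\` pball n a).
  rewrite measureD//; [|exact: measurable_pball|exact: measurable_pball].
  rewrite (_ : pball n b `&` pball n a = pball n a)//.
  apply/setIidr => v /andP[v0 va]; rewrite /pball/= v0/=.
  by rewrite (le_trans va)// ltW.
apply/seteqP; split => v /=; rewrite in_itv/= /pball/=.
  by move=> /andP[av vb]; rewrite (lt_trans a0)// vb; split => //;
    rewrite leNgt av.
move=> [/andP[v0 vb]] /negP; rewrite v0/= -ltNge => av.
by rewrite av.
Qed.

Section formula.
Variable n : nat.
Hypothesis n0 : (0 < n)%N.

(** For r > 0 this is the derivative of the volume of [pball] r, that is, the area of the sphere of
    radius r. The absolute value makes it a density on the whole line. *)
Let w (r : R) : R := n%:R * pball1_vol n * `|r| ^+ n.-1.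

Let w0 r : (0 <= w r)%R.
Proof. by rewrite mulr_ge0 ?exprn_ge0// mulr_ge0// pball1_vol_ge0. Qed.

Let cw : continuous w.
Proof.
move=> r; apply: cvgM; first exact: cvg_cst.
apply: (@continuous_comp _ _ _ (fun x : R => `|x|%R)
  (fun x : R => x ^+ n.-1)%R).
  exact: norm_continuous.
exact: exprn_continuous.
Qed.

Let mw : measurable_fun [set: R] w.
Proof. exact: continuous_measurable_fun. Qed.

Let density_annulus a b : (0 <= a < b)%R ->
  density lebesgue_measure mw w0 `]a, b] =
  (pball1_vol n * b ^+ n - pball1_vol n * a ^+ n * (0 < a)%R%:R)%:E.
Proof.
move=> /andP[a0 ab]; rewrite /density.
rewrite integral_itv_obnd_cbnd; last first.
  by apply/measurable_EFinP; exact: measurable_funTS.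
pose F (r : R) := (pball1_vol n * r ^+ n)%R.
have dF (r : R) : is_derive r 1%R F (pball1_vol n * (n%:R * r ^+ n.-1))%R.
  apply: is_derive_mulc; apply: DeriveDef; first exact: exprn_derivable.
  by rewrite exp_derive /GRing.scale/= mulr1.
have cF : continuous F.
  move=> r; apply: cvgM; first exact: cvg_cst.
  exact: exprn_continuous.
rewrite (@continuous_FTC2 _ w F) //.
- rewrite -EFinB /F; congr (_ - _)%:E; move: a0;
  rewrite le_eqVlt => /predU1P[<-|->].
    by rewrite expr0n gtn_eqF// !mulr0 mul0r.
  by rewrite mulr1.
- exact: continuous_subspaceT.
- split; first by move=> r _; exact: (@ex_derive _ _ _ _ _ _ _ (dF r)).
  + by apply: cvg_at_right_filter; exact: cF.
  + by apply: cvg_at_left_filter; exact: cF.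
- move=> r; rewrite in_itv/= => /andP[ar _].
  rewrite derive1E (@derive_val _ _ _ _ _ _ _ (dF r)) /w ger0_norm.
    by rewrite mulrCA mulrA.
  by rewrite (le_trans a0)// ltW.
Qed.

Let D := `]0%R, +oo[%classic : set R.

(** The image of Lebesgue measure under the norm and the measure of density w agree on the intervals
    ]a, b] of the positive half-line, by the volume of annuli; uniqueness of measures extends this
    to Borel sets. *)
Lemma ge0_integral_radial (f : R -> \bar R) :
  measurable_fun [set: R] f -> (forall r, 0 <= f r) ->
  \int[lebesgue_rV n]_(v in [set v | v != 0%R]) f (enorm v) =
  \int[lebesgue_measure]_(r in `]0%R, +oo[) (f r *
    (n%:R * pball1_vol n * r ^+ n.-1)%:E).
Proof.
move=> mf f0; have mD : measurable D by exact: measurable_itv.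
pose nu' : {measure set (measurableTypeR R) -> \bar R} :=
  pushforward (lebesgue_rV n) (@enorm R n : _ -> measurableTypeR R).
pose nu := nu' (@measurable_enorm n).
pose de : {measure set (measurableTypeR R) -> \bar R} :=
  density lebesgue_measure mw w0.
have nuE A : measurable A -> A `<=` D -> nu A = de A.
  (* On negative numbers the image measure vanishes and w need not, so both measures are restricted
     to D before uniqueness is invoked. *)
  move=> mA AD; rewrite -(setIidl AD).
  have /(_ A mA) : forall B : set
    (measurableTypeR R), measurable B -> mrestr nu mD B = mrestr de mD B.
    pose g (k : nat) : set R := `](- k%:R)%R, k%:R]%classic.
    have ann a b : nu (`]a, b]%classic `&` D) = de (`]a, b]%classic `&` D) /\
        nu (`]a, b]%classic `&` D) < +oo.
      have -> : `]a, b]%classic `&` D = `](Num.max a 0)%R, b]%classic.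
        apply/seteqP; split => r; rewrite /D /= !in_itv/= andbT gt_max.
          by move=> [/andP[-> ->] ->].
        by move=> /andP[/andP[-> ->] ->].
      have [ab|ba] := ltP (Num.max a 0)%R b.
        have h : (0 <= Num.max a 0 < b)%R by rewrite le_max lexx orbT.
        have e1 := density_annulus h; have e2 := annulus_vol n h.
        split; first exact: etrans e2 (esym e1).
        have := ltry (pball1_vol n * b ^+ n -
          pball1_vol n * Num.max a 0 ^+ n * (0 < Num.max a 0)%R%:R)%R.
        by rewrite -e2.
      by rewrite set_itv_ge ?measure0// bnd_simp -leNgt.
    have g_cover : \bigcup_k g k = setT.
      rewrite -subTset => r _.
      exists (Num.truncn `|r|%R).+1 => //=; rewrite /g/= in_itv/=.
      by have := truncnS_gt `|r|%R; rewrite ltr_norml => /andP[-> /ltW ->].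
    move=> B mB.
    pose m1 : {measure set (measurableTypeR R) -> \bar R} := mrestr nu mD.
    pose m2 : {measure set (measurableTypeR R) -> \bar R} := mrestr de mD.
    have := @measure_unique _ R (measurableTypeR R) (@ocitv R) g erefl
      (@ocitvI R) (fun k => is_ocitv _ _) g_cover m1 m2.
    apply => //.
    - by move=> _ [[a b] _ <-]; have [] := ann a b.
    - by move=> k; have [] := ann (- k%:R)%R k%:R.
  by [].
have -> : [set v : 'rV[R]_n | v != 0%R] = @enorm R n @^-1` D.
  by apply/seteqP; split => v; rewrite /D /= in_itv/= andbT enorm_gt0.
rewrite -[LHS](@ge0_integral_pushforward _ _ _ (measurableTypeR R) R
  (@enorm R n) (@measurable_enorm n) (lebesgue_rV n) D f)//; last first.
  exact: measurable_funTS.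
transitivity (\int[de]_(r in D) f r).
 
  exact: (@eq_measure_integral _ (measurableTypeR R) R D de nu f nuE).
rewrite integral_mkcond ge0_integral_density; last 2 first.
- by apply/(measurable_restrictT _ _).1 => //; exact: measurable_funTS.
- by move=> r; exact: erestrict_ge0.
rewrite [RHS]integral_mkcond; apply: eq_integral => r _.
rewrite /patch; case: ifPn => [|_]; last by rewrite mul0e.
by rewrite inE /D /= in_itv/= andbT => r0; rewrite /w ger0_norm// ltW.
Qed.

End formula.
End polar.

(** * Change of variables between tangent spaces and Euclidean space *)

Section tangent_integrals.
Context {R : realType} {n : nat}.
Local Open Scope ereal_scope.

(** The integral of a non-negative function is a supremum over the simple functions below it, so
    monotonicity holds for arbitrary integrands. This applies to [sup_kernel], a supremum over an
    uncountable family. *)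
Lemma le_integral_ge0 d (T : measurableType d) (mu : {measure set T -> \bar R})
    (D : set T) (f1 f2 : T -> \bar R) :
  (forall x, D x -> 0 <= f1 x) -> (forall x, D x -> f1 x <= f2 x) ->
  \int[mu]_(x in D) f1 x <= \int[mu]_(x in D) f2 x.
Proof.
move=> f10 f12; rewrite !(integral_mkcond D).
have r1 x : 0 <= (f1 \_ D) x by apply: erestrict_ge0.
have r12 x : (f1 \_ D) x <= (f2 \_ D) x.
  by rewrite /patch; case: ifPn => //; rewrite inE; exact: f12.
rewrite !ge0_integralTE//; last by move=> x; exact: le_trans (r1 x) (r12 x).
apply: ereal_sup_le => _ [h /= hf <-]; exists h => // t.
exact: le_trans (hf t) (r12 t).
Qed.

Lemma tangent_volumeE (x : 'rV[R]_n) (A : set 'rV[R]_n) : hball x ->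
  tangent_volume x A = (conformal_factor x ^+ n)%:E * lebesgue_rV n A.
Proof.
move=> xb; rewrite /tangent_volume /mscale/=; congr (_%:E * _).
rewrite /hmetric det_scalar exprAC sqrtr_sqr ger0_norm// exprn_ge0// ltW//.
exact: conformal_factor_gt0.
Qed.

(** Multiplication by lambda is an isometry from the tangent space at x onto Euclidean space. *)
Lemma pushforward_tangent_volume (x : 'rV[R]_n) (A : set 'rV[R]_n) : hball x ->
  measurable A ->
  pushforward (tangent_volume x) (fun v => conformal_factor x *: v)%R A =
    lebesgue_rV n A.
Proof.
move=> xb mA; rewrite /pushforward tangent_volumeE// lebesgue_rV_scale//.
exact: conformal_factor_gt0.
Qed.

Variables (x : 'rV[R]_n) (f : 'rV[R]_n -> R).
Hypotheses (xb : hball x) (mf : measurable_fun setT f).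
Hypothesis intf : (lebesgue_rV n).-integrable setT (EFin \o f).

Let phi (v : 'rV[R]_n) : 'rV[R]_n := (conformal_factor x *: v)%R.

Let mphi : measurable_fun setT phi. Proof. exact: measurable_scale_rV. Qed.

Let nu : {measure set 'rV[R]_n -> \bar R}.
Proof.
pose nu' : {measure set 'rV[R]_n -> \bar R} := pushforward
  (tangent_volume x) phi.
exact: (nu' mphi).
Defined.

Let nuE (A : set 'rV[R]_n) : measurable A -> nu A = lebesgue_rV n A.
Proof. exact: pushforward_tangent_volume. Qed.

Lemma integrable_tangent_scale : (tangent_volume x).-integrable setT
  (fun v => (f (conformal_factor x *: v))%:E).
Proof.
have mEf : measurable_fun setT (EFin \o f) by exact/measurable_EFinP.
apply/integrableP; split; first by apply: measurableT_comp mEf mphi.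
have /integrableP[_] := intf.
rewrite (@eq_measure_integral _ _ _ setT nu (lebesgue_rV n));
  last by move=> A mA _; rewrite nuE.
rewrite ge0_integral_pushforward//.
by apply: measurableT_comp.
Qed.

Lemma Rintegral_tangent_scale :
  (\int[tangent_volume x]_v f (conformal_factor x *: v) =
    \int[lebesgue_rV n]_v f v)%R.
Proof.
have mEf : measurable_fun setT (EFin \o f) by exact/measurable_EFinP.
congr fine; rewrite [RHS](@eq_measure_integral _ _ _ setT nu (lebesgue_rV n));
  last by move=> A mA _; rewrite nuE.
rewrite integral_pushforward// preimage_setT.
exact: integrable_tangent_scale.
Qed.

End tangent_integrals.

(** * The angular kernel *)

Section smooth_geometry.
Context {R : realType} {n : nat}.
Local Notation rV := 'rV[R]_n.

Lemma C1_at_component (V : normedModType R) (f : V -> rV) (p : V) k :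
  C1_at f p -> C1_at (fun q => f q ord0 k) p.
Proof.
move=> Cf; exact: (@C1_at_comp _ V rV R f (fun y : rV => y ord0 k) p
  (finite_basis_rV n) Cf (C1_at_coord k _)).
Qed.

Lemma C1_at_edot (V : normedModType R) (f g : V -> rV) (p : V) :
  C1_at f p -> C1_at g p -> C1_at (fun q => edot (f q) (g q)) p.
Proof.
move=> Cf Cg; apply: C1_at_sum => k.
exact: (C1_at_mul (C1_at_component k Cf) (C1_at_component k Cg)).
Qed.

Lemma C1_at_scale (V : normedModType R) (a : V -> R) (f : V -> rV) (p : V) :
  C1_at a p -> C1_at f p -> C1_at (fun q => a q *: f q) p.
Proof.
move=> Ca Cf; apply: C1_at_row => k.
under eq_fun do rewrite mxE.
exact: (C1_at_mul Ca (C1_at_component k Cf)).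
Qed.

Lemma C1_at_opp (V : normedModType R) (f : V -> rV) (p : V) :
  C1_at f p -> C1_at (fun q => - f q) p.
Proof.
move=> Cf; under eq_fun do rewrite -scaleN1r.
exact: (C1_at_scale (@C1_at_cst R V R (-1) p) Cf).
Qed.

Lemma C1_at_enorm (V : normedModType R) (f : V -> rV) (p : V) : f p != 0 ->
  C1_at f p -> C1_at (fun q => enorm (f q)) p.
Proof.
move=> fp0 Cf; under eq_fun do rewrite enormE.
apply: C1_at_sqrt; first by rewrite lt0r edot_ge0 edot_eq0 fp0.
exact: (C1_at_edot Cf Cf).
Qed.

Lemma C1_at_edir (V : normedModType R) (f : V -> rV) (p : V) : f p != 0 ->
  C1_at f p -> C1_at (fun q => edir (f q)) p.
Proof.
move=> fp0 Cf; apply: (C1_at_scale _ Cf);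
  apply: (C1_at_inv _ (C1_at_enorm fp0 Cf)).
by rewrite enorm_eq0.
Qed.

Lemma C1_at_conformal_factor (V : normedModType R) (f : V -> rV) (p : V) :
  hball (f p) -> C1_at f p -> C1_at (fun q => conformal_factor (f q)) p.
Proof.
move=> /hball_edot fp1 Cf; under eq_fun do rewrite conformal_factorE.
have Cd : C1_at (fun q => 1 - edot (f q) (f q)) p.
  under eq_fun do rewrite -mulN1r.
  exact: (C1_at_add (@C1_at_cst R V R 1 p) (C1_at_mul (@C1_at_cst R V R (-1) p)
    (C1_at_edot Cf Cf))).
have d0 : 1 - edot (f p) (f p) != 0 by rewrite gt_eqF// subr_gt0.
exact: (C1_at_mul (@C1_at_cst R V R 2 p)
  (@C1_at_inv R V (fun q => 1 - edot (f q) (f q)) p d0 Cd)).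
Qed.

Lemma C1_at_endpoint (V : normedModType R) (f u : V -> rV) (p : V) :
  hball (f p) -> edot (u p) (u p) = 1 -> C1_at f p -> C1_at u p ->
  C1_at (fun q => endpoint (f q) (u q)) p.
Proof.
move=> fp up Cf Cu.
have Cl : C1_at (fun q => conformal_factor (f q) * (1 + edot (f q) (u q))) p.
  exact: (C1_at_mul (C1_at_conformal_factor fp Cf)
    (C1_at_add (@C1_at_cst R V R 1 p) (C1_at_edot Cf Cu))).
have d0 : conformal_factor (f p) * (1 + edot (f p) (u p)) + - 1 != 0.
  by rewrite gt_eqF// endpoint_denom_gt0.
exact: (C1_at_scale (@C1_at_inv R V
    (fun q => conformal_factor (f q) * (1 + edot (f q) (u q)) + - 1) p d0
    (C1_at_add Cl (@C1_at_cst R V R (- 1) p)))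
  (C1_at_add (C1_at_scale Cl Cf) Cu)).
Qed.

Lemma open_hball : open (@hball R n).
Proof.
rewrite (_ : hball = @enorm R n @^-1` [set r | r < 1]); last by [].
by apply: open_comp => [x _|]; [exact: continuous_enorm|exact: open_lt].
Qed.

Lemma open_nonzero : open [set v : rV | v != 0].
Proof.
rewrite (_ : mkset _ = @enorm R n @^-1` [set r | 0 < r]); last first.
  by apply/seteqP; split => v /=; rewrite enorm_gt0.
by apply: open_comp => [x _|]; [exact: continuous_enorm|exact: open_gt].
Qed.

Definition tangent_nonzero : set (rV * rV) := [set p | hball p.1 /\ p.2 != 0].

Lemma open_tangent_nonzero : open tangent_nonzero.
Proof.
rewrite (_ : tangent_nonzero = (fst @^-1` @hball R n) `&`
  (snd @^-1` [set v : rV | v != 0])) //.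
apply: openI; apply: open_comp => [p _|]; [exact: cvg_fst|exact: open_hball|
  exact: cvg_snd|exact: open_nonzero].
Qed.

Lemma compact_esphere : compact (esphere R n).
Proof.
apply: bounded_closed_compact.
  exists 1; split => // r r1 v /= v1; apply: le_trans (ltW r1).
  rewrite /Num.Def.normr/= mx_normrE; apply: bigmax_le => // -[i j] _.
  by rewrite /= ord1 -v1; exact: normr_coord_le.
rewrite (_ : esphere R n = @enorm R n @^-1` [set 1]) //.
by apply: closed_comp => [x _|]; [exact: continuous_enorm|exact: closed_eq].
Qed.

Section kernel.
Variable g1 : rV -> rV -> R.
Hypothesis g1C : C1_on_submanifold (esphere R n `*` esphere R n)
  (fun p : rV * rV => g1 p.1 p.2).

Definition ends (p : rV * rV) : rV * rV :=
  (endpoint p.1 (- edir p.2), endpoint p.1 (edir p.2)).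

Lemma ends_sphere p : tangent_nonzero p ->
  (esphere R n `*` esphere R n) (ends p).
Proof.
move=> [xb V0]; have s := esphere_edir V0.
split; apply: esphere_endpoint => //.
apply/esphere_edot; rewrite edotNl edotNr opprK.
exact/esphere_edot.
Qed.

Lemma C1_at_ends p : tangent_nonzero p -> C1_at ends p.
Proof.
move=> [xb V0]; have /esphere_edot s := esphere_edir V0.
have Cd := C1_at_edir V0 (C1_at_snd p).
have s' : edot (- edir p.2) (- edir p.2) = 1 by rewrite edotNl edotNr opprK.
exact: (C1_at_pair (C1_at_endpoint xb s' (C1_at_fst p) (C1_at_opp Cd))
  (C1_at_endpoint xb s (C1_at_fst p) Cd)).
Qed.

Definition angular (p : rV * rV) : R := g1 (ends p).1 (ends p).2.

(** Only local extensions h of [g1] off the spheres are C^1. Since [ends] takes all of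
    [tangent_nonzero] into the product of spheres, h composed with [ends] equals [angular] near
    p. *)
Lemma C1_at_angular p : tangent_nonzero p -> C1_at angular p.
Proof.
move=> tp; have [U [h [oU Up hC hE]]] := g1C (ends_sphere tp).
have Ce := C1_at_ends tp.
apply: (@near_eq_C1_at _ _ _ (h \o ends)); last first.
  exact: (C1_at_comp (finite_basis_pair (finite_basis_rV n)
    (finite_basis_rV n)) Ce
    ((C1_onP h oU).1 hC _ Up)).
near=> q; apply: hE; split; last first.
  apply: ends_sphere; near: q; apply: open_nbhs_nbhs; split => //.
  exact: open_tangent_nonzero.
near: q; apply: (C1_at_continuous Ce); exact: open_nbhs_nbhs.
Unshelve. all: by end_near. Qed.

(** Homogeneity of degree 0, which confines the second variable to the compact sphere. *)
Lemma angular_edir x V : V != 0 -> angular (x, edir V) = angular (x, V).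
Proof.
move=> V0; rewrite /angular /ends /=.
have /= s := esphere_edir V0.
by rewrite (_ : edir (edir V) = edir V)// {1}/edir s invr1 scale1r.
Qed.

(** Each local extension is bounded near its point p by |h(p)| + 1; compactness of the product of
    spheres gives a common bound. *)
Lemma sphere_bounded : exists M, 0 <=
  M /\ forall s s', esphere R n s -> esphere R n s' ->
  `|g1 s s'| <= M.
Proof.
have cS := compact_setX compact_esphere compact_esphere.
pose P (C : R) (p : rV * rV) := `|g1 p.1 p.2| <= C.
have : \forall C \near +oo, esphere R n `*` esphere R n `<=` P C.
  apply: ((near_covering_withinP _).2 ((compact_near_coveringP _).1 cS) _ _ P).
  move=> p Sp; have [U [h [oU Up hC hE]]] := g1C Sp.
  have /cvgrPdist_le/(_ 1 ltr01) hc := C1_at_continuous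
    ((C1_onP h oU).1 hC p Up).
  have nU : \forall q \near p, U q by apply: open_nbhs_nbhs.
  near=> q C.
  have hpC : `|h p| + 1 <= C by near: C; apply: nbhs_pinfty_ge; exact: num_real.
  move=> Sq; rewrite /P -(hE q); last by split => //; near: q.
  have h1 : `|h p - h q| <= 1 by near: q.
  apply: (@le_trans _ _ (`|h p| + 1)); last exact: hpC.
  by rewrite -lerBlDl (le_trans (lerB_dist _ _))// distrC.
move=> [C [_ hC]]; exists (Num.max (C + 1) 0); split;
  first by rewrite le_max lexx orbT.
move=> s s' Ss Ss'; apply: (hC _ _ (s, s')) => //.
by rewrite lt_max ltrDl ltr01.
Unshelve. all: by end_near. Qed.

End kernel.
End smooth_geometry.

(** * Verification of hypotheses (A), (B) and (C) *)

Section separated_kernel.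
Context {R : realType} {N : nat}.
Local Notation rV := 'rV[R]_N.
Variables (g1 : rV -> rV -> R) (xi : R -> R) (G : rV -> rV -> R).
Hypothesis N0 : (0 < N)%N.
Hypothesis g1_ge0 : forall s s' : rV, esphere R N s -> esphere R N s' -> 0 <=
  g1 s s'.
Hypothesis g1C : C1_on_submanifold (esphere R N `*` esphere R N)
  (fun p : rV * rV => g1 p.1 p.2).
Hypothesis xi_ge0 : forall r : R, 0 < r -> 0 <= xi r.
Hypothesis xiC : C1_on [set r : R | 0 < r] xi.
Hypothesis xi_int : (\int[lebesgue_measure]_(r in `]0%R, +oo[)
  (xi r * radial_weight N r)%:E < +oo)%E.
Hypothesis G_sep : forall x V : rV, hball x -> V != 0 ->
  G x V = g1 (sigma_minus x V) (sigma_plus x V) * xi (hnorm x V).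
Hypothesis G0 : forall x : rV, hball x -> 0 <= G x 0.

Lemma G_angular x V : hball x -> V != 0 ->
  G x V = angular g1 (x, V) * xi (conformal_factor x * enorm V).
Proof.
move=> xb V0; rewrite G_sep// hnormE//.
by have [-> ->] := sigmaE xb V0.
Qed.

Lemma C1_at_xi r : 0 < r -> C1_at xi r.
Proof. by move=> r0; exact: ((C1_onP xi (@open_gt R 0)).1 xiC r r0). Qed.

Lemma separated_hypothesisA : hypothesisA G.
Proof.
split=> [x V xb|p|t [x V] /= xb].
- have [->|V0] := eqVneq V 0; first exact: G0.
  rewrite G_sep// mulr_ge0 ?xi_ge0 ?hnorm_gt0//.
  have [s1 s2] := @ends_sphere R N (x, V) (conj xb V0).
  by have [-> ->] := sigmaE xb V0; exact: g1_ge0.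
- move: p; apply/(C1_onP _ open_tangent_nonzero) => -[x V] [/= xb V0].
  have r0 : 0 < conformal_factor x * enorm V.
    by rewrite mulr_gt0 ?conformal_factor_gt0// enorm_gt0.
  have C1 := @C1_at_angular R N g1 g1C (x, V) (conj xb V0).
  have C2 : C1_at (fun q : rV * rV => conformal_factor q.1 * enorm q.2) (x, V).
    exact: (C1_at_mul (C1_at_conformal_factor xb (C1_at_fst (x, V)))
      (C1_at_enorm V0 (C1_at_snd (x, V)))).
  have C3 : C1_at (fun q : rV * rV => xi (conformal_factor q.1 * enorm q.2))
    (x, V).
    exact: (@C1_at_comp R (rV * rV)%type R R
      (fun q : rV * rV => conformal_factor q.1 * enorm q.2) xi (x, V)
      (@finite_basis_R R) C2 (C1_at_xi r0)).
  apply: near_eq_C1_at (C1_at_mul C1 C3).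
  have : \forall q \near (x, V), tangent_nonzero q.
    by apply: open_nbhs_nbhs; split => //; exact: open_tangent_nonzero.
  by apply: filterS => -[y W] [/= yb W0]; rewrite G_angular.
(* On the zero section the geodesic is constant, so invariance holds whatever value [G] takes
   there. *)
- have [->|V0] := eqVneq V 0.
    have d0 : derive1 (cst x) = cst (0 : rV) :> (R -> rV).
      by apply/funext => s; rewrite derive1_cst.
    by rewrite /geodesic_flow /= geodesic0// d0.
  have [qb q0 hn e1 e2] := geodesic_flow_invariants t xb V0.
  by rewrite !G_sep// hn e1 e2.
Qed.

Lemma sphere_measure_fin : (sphere_measure (esphere R N) < +oo)%E.
Proof.
rewrite /sphere_measure (_ : cone _ = @pball R N 1).
  by rewrite pball1_volE -EFinM ltry.
apply/seteqP; split => v /=.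
  move=> [t [s [/andP[t0 t1] s1 ->]]]; rewrite /pball/= enormZ gtr0_norm//.
  by rewrite (s1 : enorm s = 1) mulr1 t0.
rewrite /pball/= => v01; have /andP[v0 v1] := v01; exists (enorm v), (edir v);
  split => //.
  by apply: esphere_edir; rewrite -enorm_gt0.
by rewrite /edir scalerA mulfV ?scale1r// gt_eqF.
Qed.

Lemma sinh_ge0 (r : R) : 0 <= r -> 0 <= sinh r.
Proof.
by move=> r0; rewrite /sinh divr_ge0// subr_ge0 ler_expR; lra.
Qed.

Lemma radial_weight_ge0 (r : R) : 0 < r -> 0 <= radial_weight N r.
Proof.
move=> r0; apply: mulr_ge0; first by rewrite addr_ge0// ltW.
by apply: exprn_ge0; apply: mulr_ge0; [exact: expR_ge0|exact/sinh_ge0/ltW].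
Qed.

(** e^r sinh r = (e^{2r} - 1) / 2 >= r. The left side is the first moment against the polar weight,
    so [xi_int] controls the moments of xi(|Z|). *)
Lemma radial_weight_ge (r : R) : 0 < r -> r * r ^+ N.-1 <= radial_weight N r.
Proof.
move=> r0; have r0' := ltW r0.
apply: ler_pM => //; [exact: exprn_ge0|by rewrite lerDr|].
have s0 : 0 <= expR r * sinh r by apply: mulr_ge0;
  [exact: expR_ge0|exact: sinh_ge0].
apply: lerXn2r => //.
rewrite /sinh mulrA ler_pdivlMr// mulrBr -expRD -expRD subrr expR0.
have := expR_ge1Dx (r + r); lra.
Qed.

Lemma continuous_sinh : continuous (@sinh R).
Proof.
move=> r; apply: cvgM; last exact: cvg_cst.
apply: cvgB; first exact: continuous_expR.
apply: (@continuous_comp _ _ _ (fun r : R => - r) expR);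
  last exact: continuous_expR.
exact: opp_continuous.
Qed.

Lemma measurable_radial_weight : measurable_fun [set: R] (radial_weight N).
Proof.
apply: measurable_funM; first by apply: measurable_funD.
apply: measurable_funX; apply: measurable_funM; first exact: measurable_expR.
by apply: continuous_measurable_fun; exact: continuous_sinh.
Qed.

Lemma measurable_xi : measurable_fun (`]0%R, +oo[%classic : set R) xi.
Proof.
apply: open_continuous_measurable_fun; first exact: interval_open.
by move=> r; rewrite inE/= in_itv/= andbT => /C1_at_xi/C1_at_continuous.
Qed.

Lemma separated_hypothesisB : hypothesisB G.
Proof.
have [M [M0 hM]] := sphere_bounded g1C.
rewrite /hypothesisB; apply: lte_mul_pinfty.
- by rewrite /sphere_measure mule_ge0// lee_fin.
- by rewrite ge0_fin_numE ?sphere_measure_fin// /sphere_measure mule_ge0//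
  lee_fin.
apply: (@le_lt_trans _ _ (\int[lebesgue_measure]_(r in `]0%R, +oo[)
    (M%:E * (xi r * radial_weight N r)%:E))%E); last first.
  rewrite ge0_integralZl_EFin//.
  - by apply: lte_mul_pinfty.
  - by move=> r /=; rewrite in_itv/= andbT => r0;
    rewrite lee_fin mulr_ge0 ?xi_ge0 ?radial_weight_ge0.
  - by apply/measurable_EFinP;
    exact: (measurable_funM measurable_xi
      (measurable_funTS measurable_radial_weight)).
apply: le_integral_ge0 => r /=; rewrite in_itv/= andbT => r0.
  apply: mule_ge0; last by rewrite lee_fin radial_weight_ge0.
  (* The supremum is non-negative only if it is taken over a non-empty set. At the origin lambda =
     2, so this vector has hyperbolic norm r; its existence uses N > 0. *)
  pose V : rV := (r / 2) *: delta_mx ord0 (Ordinal N0).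
  have b0 : hball (0 : rV).
    by apply/hball_edot;
      rewrite -[X in edot X _](scale0r (0 : rV)) edotZl mul0r.
  have hV : hnorm 0 V = r.
    rewrite hnormE// conformal_factorE -[X in edot X _](scale0r
      (0 : rV)) edotZl mul0r subr0 divr1.
    rewrite enormZ enormE edot_delta mxE !eqxx sqrtr1 mulr1 gtr0_norm
      ?divr_gt0//.
    by rewrite mulrC divfK.
  have V0 : V != 0.
    apply/eqP => VE; move: r0; rewrite -hV VE hnormE//.
    by rewrite (_ : enorm 0 = 0) ?mulr0 ?ltxx//; apply/eqP; rewrite enorm_eq0.
  apply: (@le_trans _ _ (G 0 V)%:E).
    by rewrite lee_fin; have [h _ _] := separated_hypothesisA; exact: h.
  by apply: ereal_sup_ubound; exists (0, V).
rewrite (EFinM (xi r)) muleA; apply: lee_wpmul2r;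
  first by rewrite lee_fin radial_weight_ge0.
apply: ge_ereal_sup => _ [[x V] /= [xb hV] <-].
have V0 : V != 0.
  apply/eqP => VE; move: r0; rewrite -hV VE hnormE//.
  by rewrite (_ : enorm 0 = 0) ?mulr0 ?ltxx//; apply/eqP; rewrite enorm_eq0.
rewrite -EFinM lee_fin G_sep// hV ler_wpM2r ?xi_ge0//.
have [s1 s2] := @ends_sphere R N (x, V) (conj xb V0).
have [-> ->] := sigmaE xb V0.
by rewrite (le_trans (ler_norm _))// hM.
Qed.

Let D : set rV := [set v | v != 0].

Let mD : measurable D.
Proof. by apply: measurable_open_rV; exact: open_nonzero. Qed.

Let m (i : 'I_N) (Z : rV) : R := xi (enorm Z) * Z ord0 i.

Lemma measurable_on_directions (F : rV * rV -> R) x :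
  (forall u, esphere R N u -> {for (x, u), continuous F}) ->
  measurable_fun D (fun Z => F (x, edir Z)).
Proof.
move=> cF; apply: continuous_on_measurable_fun; first exact: open_nonzero.
move=> Z Z0.
have c1 : (x, edir W) @[W --> Z] --> (x, edir Z).
  exact: (C1_at_continuous (C1_at_pair (C1_at_cst x Z) (C1_at_edir Z0
    (C1_at_id Z)))).
exact: (continuous_comp c1 (cF _ (esphere_edir Z0))).
Qed.

Lemma measurable_m i : measurable_fun D (m i).
Proof.
apply: continuous_on_measurable_fun; first exact: open_nonzero.
move=> Z Z0.
have e0 : 0 < enorm Z by rewrite enorm_gt0.
have c1 : xi (enorm W) @[W --> Z] --> xi (enorm Z).
  exact: (continuous_comp (@continuous_enorm R N Z) (C1_at_continuous
    (C1_at_xi e0))).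
exact: (cvgM c1 (@coord_continuous R 1 N ord0 i Z)).
Qed.

(** |m_i(Z)| is at most xi(|Z|) |Z|, a radial function, whose polar integral is bounded through
    [radial_weight_ge]. *)
Lemma integrable_m i : (lebesgue_rV N).-integrable D (EFin \o m i).
Proof.
pose I0 : set R := `]0%R, +oo[%classic.
(* Nothing is known of xi at r <= 0, so it is cut off there to obtain a measurable non-negative
   function on the line. *)
pose f : R -> R := (fun r => xi r * r) \_ I0.
have mI0 : measurable I0 by exact: measurable_itv.
have f0 r : 0 <= f r.
  rewrite /f /patch; case: ifPn => //; rewrite inE /I0/= in_itv/= andbT => r0.
  by rewrite mulr_ge0 ?xi_ge0// ltW.
have mf : measurable_fun setT f.
  apply/(measurable_restrictT _ mI0); apply: measurable_funM => //.
  exact: measurable_xi.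
apply/integrableP; split; first by apply/measurable_EFinP; exact: measurable_m.
apply: (@le_lt_trans _ _ (\int[lebesgue_rV N]_(v in D) (f (enorm v))%:E)%E).
  apply: le_integral_ge0 => Z Z0; first exact: abse_ge0.
  have e0 : 0 < enorm Z by rewrite enorm_gt0.
  rewrite /= lee_fin /m normrM (ger0_norm (xi_ge0 e0)) /f /patch ifT;
    last first.
    by rewrite inE /I0/= in_itv/= e0.
  by rewrite ler_wpM2l ?xi_ge0// normr_coord_le.
rewrite (@ge0_integral_radial R N N0 (EFin \o f)); last 2 first.
- exact/measurable_EFinP.
- by move=> r; rewrite lee_fin.
apply: (@le_lt_trans _ _ (\int[lebesgue_measure]_(r in `]0%R, +oo[)
    ((N%:R * @pball1_vol R N)%:E * (xi r * radial_weight N r)%:E))%E).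
  apply: le_integral_ge0 => r /=; rewrite in_itv/= andbT => r0.
    apply: mule_ge0; rewrite lee_fin ?f0//; apply: mulr_ge0;
      last exact/exprn_ge0/ltW.
    by rewrite mulr_ge0// pball1_vol_ge0.
  rewrite -!EFinM lee_fin /f /patch ifT; last by rewrite inE /I0/= in_itv/= r0.
  have c0 : 0 <= N%:R * @pball1_vol R N by rewrite mulr_ge0// pball1_vol_ge0.
  have := ler_wpM2l (mulr_ge0 c0 (xi_ge0 r0)) (radial_weight_ge r0).
  by rewrite -[X in _ <= X -> _]mulrA; congr (_ <= _); ring.
rewrite ge0_integralZl_EFin//.
- by apply: lte_mul_pinfty => //; rewrite lee_fin mulr_ge0// pball1_vol_ge0.
- by move=> r /=; rewrite in_itv/= andbT => r0;
  rewrite lee_fin mulr_ge0 ?xi_ge0 ?radial_weight_ge0.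
- by apply/measurable_EFinP;
  exact: (measurable_funM measurable_xi
    (measurable_funTS measurable_radial_weight)).
- by rewrite mulr_ge0// pball1_vol_ge0.
Qed.

Let K (x Z : rV) : R := angular g1 (x, edir Z).

(** Composing the differential of [angular] with this inclusion gives its partial differential in x,
    packaged as the linear map [L]. *)
Let pair_zero (v : rV) : rV * rV := (v, 0).

Let pair_zero_linear : linear pair_zero.
Proof. by move=> a u v; apply: injective_projections;
  rewrite /= ?scaler0 ?addr0. Qed.

HB.instance Definition _ := GRing.isLinear.Build R rV
  (rV * rV)%type _ pair_zero pair_zero_linear.

Let L (x Z : rV) : {linear rV -> R} := 'd (angular g1) (x, edir Z) \o pair_zero.

Let angular_dir x u : hball x -> esphere R N u -> C1_at (angular g1) (x, u).
Proof.
move=> xb u1; apply: (C1_at_angular g1C); split => //=.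
by rewrite -enorm_gt0 (u1 : enorm u = 1).
Qed.

Lemma measurable_K x : hball x -> measurable_fun D (K x).
Proof.
by move=> xb; apply: measurable_on_directions => u /(angular_dir
  xb)/C1_at_continuous.
Qed.

Lemma K_bounded x : hball x -> exists C : R, forall Z, D Z -> `|K x Z| <= C.
Proof.
move=> xb; have [M [_ hM]] := sphere_bounded g1C; exists M => Z Z0.
have u1 := esphere_edir Z0.
have [s1 s2] : (esphere R N `*` esphere R N) (ends (x, edir Z)).
  by apply: ends_sphere; split => //=;
    rewrite -enorm_gt0 (u1 : enorm (edir Z) = 1).
exact: hM.
Qed.

Lemma C1_at_angular_integral i x : hball x ->
  C1_at (fun y => \int[lebesgue_rV N]_(Z in D) (K y Z * m i Z)) x.
Proof.
apply: (@C1_at_Rintegral R rV _ rV (lebesgue_rV N) D (m i) (@hball R N) K L mD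
  (integrable_m i) (finite_basis_rV N) open_hball measurable_K) => //.
- move=> y v yb.
  apply: (@measurable_on_directions (fun p => 'd (angular g1) p
    (v, 0))) => u u1.
  by have [_] := angular_dir yb u1; exact.
- exact: K_bounded.
- move=> y v yb; have [C hC] := partial_bounded (@compact_esphere R N)
  (fun u => angular_dir yb) v.
  by exists C => Z /esphere_edir; exact: hC.
- move=> y e yb e0.
  have := uniform_partial_diff (finite_basis_rV N) (finite_basis_rV N)
    (@compact_esphere R N) (fun u => angular_dir yb) e0.
  by apply: filterS => h hh Z /esphere_edir; exact: hh.
- move=> y v e yb e0.
  have := uniform_partial_continuous (@compact_esphere R N)
    (fun u => angular_dir yb) v e0.
  by apply: filterS => z hz Z /esphere_edir; exact: hz.
Qed.

(** The integrand after the substitution Z = lambda W. The factor 1/lambda cancels the lambda in the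
    coordinate of lambda W, and the value at Z = 0 is set to zero. *)
Let H (i : 'I_N) (x : rV) : rV -> R :=
  fun Z => (conformal_factor x)^-1 * ((fun W => K x W * m i W) \_ D) Z.

(** At W = 0 both sides vanish because of the factor W_i, whatever [G] is there; elsewhere [K]
    depends only on the direction, which scaling by lambda preserves. *)
Lemma moment_scale i x W : hball x ->
  G x W * W ord0 i = H i x (conformal_factor x *: W).
Proof.
move=> xb; have l0 := conformal_factor_gt0 xb.
have [->|W0] := eqVneq W 0.
  rewrite /H mxE mulr0 scaler0 /patch; case: ifPn; rewrite ?mulr0//.
  by rewrite inE /D/= eqxx.
have lW0 : conformal_factor x *: W != 0 by rewrite scaler_eq0 negb_or W0 gt_eqF.
rewrite /H /patch ifT ?inE// /K angular_edir// /m enormZ gtr0_norm// mxE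
  G_angular//.
rewrite /angular (_ : ends (x, conformal_factor x *: W) = ends (x, W)).
  by field; rewrite gt_eqF.
rewrite /ends /= (_ : edir (conformal_factor x *: W) = edir W)//.
rewrite /edir enormZ gtr0_norm// scalerA; congr (_ *: _).
by field; rewrite ?enorm_eq0 W0 gt_eqF.
Qed.

Let iKm i x : hball x -> (lebesgue_rV N).-integrable D (EFin \o
  (fun W => K x W * m i W)).
Proof.
move=> xb; apply: (integrable_bounded_mul mD (integrable_m i));
  first exact: measurable_K.
exact: K_bounded.
Qed.

Let iKm_restrict i x : hball x ->
  (lebesgue_rV N).-integrable setT (EFin \o ((fun W => K x W * m i W) \_ D)).
Proof.
by move=> xb; rewrite -restrict_EFin;
  exact: ((integrable_mkcond _ mD).1 (iKm i xb)).
Qed.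

Let iH i x : hball x -> (lebesgue_rV N).-integrable setT (EFin \o H i x).
Proof. by move=> xb;
  exact: (integrableZl measurableT _ (iKm_restrict i xb)). Qed.

Let mH i x : hball x -> measurable_fun setT (H i x).
Proof. by move=> xb; apply/measurable_EFinP;
  exact: (measurable_int (lebesgue_rV N) (iH i xb)). Qed.

Lemma separated_hypothesisC : hypothesisC G.
Proof.
split => [x i xb|].
  under eq_fun do rewrite moment_scale//.
  exact: (integrable_tangent_scale xb (mH i xb) (iH i xb)).
apply/(C1_onP _ open_hball) => x xb; apply: C1_at_row => i.
have CI := C1_at_angular_integral i xb.
have l0 : conformal_factor x != 0 by rewrite gt_eqF// conformal_factor_gt0.
have Cl := @C1_at_inv R rV (@conformal_factor R N) x l0
  (C1_at_conformal_factor xb (C1_at_id x)).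
apply: (near_eq_C1_at _ (C1_at_mul (@C1_at_cst R rV R (-1) x)
  (C1_at_mul Cl CI))).
have : \forall y \near x, hball y by apply: open_nbhs_nbhs; split => //;
  exact: open_hball.
apply: filterS => y yb; rewrite mulN1r /mean_field !mxE; congr (- _).
under [RHS]eq_Rintegral do rewrite moment_scale//.
rewrite (Rintegral_tangent_scale yb (mH i yb) (iH i yb)).
rewrite (RintegralZl _ measurableT (iKm_restrict i yb)).
by rewrite Rintegral_mkcond.
Qed.

End separated_kernel.

Theorem proposition6p1 (R : realType) (N : nat)
    (g : 'rV[R]_N -> 'rV[R]_N -> R -> R)
    (g1 : 'rV[R]_N -> 'rV[R]_N -> R) (xi : R -> R)
    (G : 'rV[R]_N -> 'rV[R]_N -> R) :
  (0 < N)%N ->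
  (forall s s' : 'rV[R]_N, esphere R N s -> esphere R N s' -> 0 <= g1 s s') ->
  C1_on_submanifold (esphere R N `*` esphere R N)
    (fun p : 'rV[R]_N * 'rV[R]_N => g1 p.1 p.2) ->
  (forall r : R, 0 < r -> 0 <= xi r) ->
  C1_on [set r : R | 0 < r] xi ->
  (\int[lebesgue_measure]_(r in `]0%R, +oo[)
     (xi r * radial_weight N r)%:E < +oo)%E ->
  (forall (s s' : 'rV[R]_N) (r : R), esphere R N s -> esphere R N s' -> 0 < r ->
     g s s' r = g1 s s' * xi r) ->
  (forall x V : 'rV[R]_N, hball x -> V != 0 ->
     G x V = g (sigma_minus x V) (sigma_plus x V) (hnorm x V)) ->
  (forall x : 'rV[R]_N, hball x -> 0 <= G x 0) ->
  [/\ hypothesisA G, hypothesisB G & hypothesisC G].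
Proof.
move=> N0 g1_ge0 g1C xi_ge0 xiC xi_int gE GE G0.
have G_sep x V : hball x -> V != 0 ->
    G x V = g1 (sigma_minus x V) (sigma_plus x V) * xi (hnorm x V).
  (* The product formula for g holds only at points of the sphere and r > 0, so the endpoints are
     first shown to lie on the sphere. *)
  move=> xb V0; have [s1 s2] := @ends_sphere R N (x, V) (conj xb V0).
  by rewrite GE//; have [-> ->] := sigmaE xb V0; rewrite gE// hnorm_gt0.
split; first exact: (separated_hypothesisA g1_ge0 g1C xi_ge0 xiC G_sep G0).
- exact: (separated_hypothesisB N0 g1_ge0 g1C xi_ge0 xiC xi_int G_sep G0).
- exact: (separated_hypothesisC N0 g1C xi_ge0 xiC xi_int G_sep).
Qed.
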